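(* Assume that $n_b/n\to\theta$ as $n\to\infty$ for some $\theta\in(0,1)$. Let $\alpha_\theta=(\theta(1-\theta))^{-1/2}$. For each $\lambda>1$, let $(\ell(\lambda),\rho(\lambda))$ be the unique solution $(\ell,\rho)$ in $(0,1)\times(0,1)$ of the system $$\rho\ell=\theta\big(1-e^{-\alpha_\theta\lambda(1-\rho)\ell}\big),\qquad (1-\rho)\ell=(1-\theta)\big(1-e^{-\alpha_\theta\lambda\rho\ell}\big).$$ Then $\lambda\mapsto\ell(\lambda)$ is a bijection from $(1,\infty)$ to $(0,1)$. Denote by $\ell^{-1}$ the inverse function. For each $s\in(0,1)$, we have $$\rho^{(n)}_{\lfloor sn\rfloor}\xrightarrow{n\to\infty}\rho\circ\ell^{-1}(s)\quad\text{in probability.}$$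
   Context: For each $n$, let $n_b=n_b(n)$ and $n_w=n_w(n)$ be natural numbers with $n_b+n_w=n$. Let $K_{n_b,n_w}$ be the complete bipartite graph on the vertex set $V_n=V^b_n\cup V^w_n$ (disjoint union), $|V^b_n|=n_b$ (black vertices), $|V^w_n|=n_w$ (white vertices), with edge set $E_n=\{\{v,w\}:v\in V^b_n,w\in V^w_n\}$. Let $\{U_e:e\in E_n\}$ be i.i.d. uniform random variables on $(0,1)$ (a.s. all distinct). Prim's Algorithm: $\sigma(1)$ is a uniform element of $V_n$ (independent of the weights). For $2\le k\le n$, given $\Sigma(k-1)=\{\sigma(i):1\le i\le k-1\}$, let $e_{k-1}$ be the a.s. unique edge minimizing $U_e$ among all edges $e=\{v,v'\}\in E_n$ with $v\in\Sigma(k-1)$, $v'\in V_n\setminus\Sigma(k-1)$; let $\sigma(k)$ be the endpoint of $e_{k-1}$ not in $\Sigma(k-1)$. For $1\le k\le n$, $\Sigma(k)=\{\sigma(i):1\le i\le k\}$, $\Sigma^b(k)=\Sigma(k)\cap V^b_n$, and $\rho^{(n)}_k=|\Sigma^b(k)|/k$ is the proportion of black vertices among the first $k$ vertices. (The function $\rho(\lambda)$ in the claim is a deterministic function, distinct from the random variables $\rho^{(n)}_k$.) *)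

(* Defs.v *)
From HB Require Import structures.
From mathcomp Require Export all_boot all_order all_algebra.
From mathcomp Require Export all_classical all_reals all_analysis.

Set Implicit Arguments.
Unset Strict Implicit.
Unset Printing Implicit Defensive.

Import Order.TTheory GRing.Theory Num.Theory.
Import numFieldNormedType.Exports.

Local Open Scope classical_set_scope.
Local Open Scope ring_scope.

(* [inl] is black, [inr] is white. *)
Definition vertex (b w : nat) : finType := ('I_b + 'I_w)%type.

(* In the complete bipartite graph, a pair [e] stands for the edge
   {inl e.1, inr e.2}; this is a bijection between pairs and edges. *)
Definition edge (b w : nat) : finType := ('I_b * 'I_w)%type.

Definition black (b w : nat) : {set vertex b w} :=
  [set v : vertex b w | if v is inl _ then true else false]%SET.

Section Prim.
Context (R : realType) (b w : nat).
Local Notation V := (vertex b w).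
Local Notation E := (edge b w).
Implicit Types (u : E -> R) (S : {set V}) (e : E).

Definition crossing S e : bool := ((inl e.1 : V) \in S) != ((inr e.2 : V) \in S).

(* The minimizer is unique when the weights are distinct; ties are broken by
   an arbitrary deterministic rule. [None] means that no edge leaves [S]. *)
Definition prim_edge u S : option E :=
  [pick e | crossing S e & [forall e', crossing S e' ==> (u e <= u e')]].

(* The endpoint of a crossing edge [e] that is not in [S]. *)
Definition outer_end S e : V := if (inl e.1 : V) \in S then inr e.2 else inl e.1.

Definition prim_step u S : {set V} :=
  if prim_edge u S is Some e then (outer_end S e |: S)%SET else S.

(* The set of the first [k] vertices visited when starting from [v0]. *)
Definition prim_set u (v0 : V) (k : nat) : {set V} :=
  if k is k'.+1 then iter k' (prim_step u) [set v0]%SET else finset.set0.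

Definition black_ratio u (v0 : V) (k : nat) : R :=
  #|(prim_set u v0 k :&: black b w)%SET|%:R / k%:R.

End Prim.

Section Randomness.
Context d (T : measurableType d) (R : realType) (P : probability T R).

Definition mutually_independent (I : finType) (X : I -> {RV P >-> R}) : Prop :=
  forall (J : {set I}) (B : I -> set R), (forall i, measurable (B i)) ->
    P (\bigcap_(i in [set` J]) (X i @^-1` B i)) =
    (\prod_(i in J) P (X i @^-1` B i))%E.

Definition sigma_of (I : Type) (X : I -> {RV P >-> R}) : set (set T) :=
  <<s \bigcup_i preimage_set_system setT (X i) measurable >>.

Definition iid_uniform01 (I : finType) (X : I -> {RV P >-> R}) : Prop :=
  mutually_independent X /\
  forall i (B : set R), measurable B ->
    P (X i @^-1` B) = uniform_prob (@ltr01 R) B.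

Definition uniform_element (F : finType) (Y : T -> F) : Prop :=
  forall v, measurable (Y @^-1` [set v]) /\
            P (Y @^-1` [set v]) = (#|F|%:R^-1)%:E.

Definition independent_of (F : finType) (Y : T -> F)
    (I : Type) (X : I -> {RV P >-> R}) : Prop :=
  forall (A : set F) (C : set T), sigma_of X C ->
    P ((Y @^-1` A) `&` C) = (P (Y @^-1` A) * P C)%E.

End Randomness.

(* The variables may live on different probability spaces; the limit is a
   constant. *)
Definition cvg_in_probability (R : realType) (d : nat -> measure_display)
    (T : forall n, measurableType (d n)) (P : forall n, probability (T n) R)
    (X : forall n, T n -> R) (c : R) : Prop :=
  forall eps : R, 0 < eps ->
    (fun n => P n [set x | eps < `|X n x - c|]) @ \oo --> 0%E.

Definition alpha (R : realType) (theta : R) : R :=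
  (theta * (1 - theta)) `^ (- 2^-1).

Definition is_solution (R : realType) (theta lambda : R) (p : R * R) : Prop :=
  let: (l, r) := p in
  [/\ 0 < l < 1, 0 < r < 1,
      r * l = theta * (1 - expR (- (alpha theta * lambda * (1 - r) * l))) &
      (1 - r) * l = (1 - theta) * (1 - expR (- (alpha theta * lambda * r * l)))].

(* Main.v *)
Require Import Defs.
From mathcomp Require Import ring lra zify.
Set Implicit Arguments.
Unset Strict Implicit.
Unset Printing Implicit Defensive.
Import Order.TTheory GRing.Theory Num.Theory.
Import numFieldNormedType.Exports.
Local Open Scope ring_scope.

(** Call an edge open if its weight is at most p = 1 - exp(-a/n), where
    a = alpha lambda. Run Prim's algorithm until at least m ~ e n vertices have
    been visited and no open edge leaves the visited set S. At most m vertices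
    of S were then entered through a closed edge, so up to an error of order m
    the black vertices of S are those joined to a white vertex of S by an open
    edge, and vice versa.

    Fix a colour c. Counting the unvisited vertices of colour c not yet hit by
    an open edge, with weight (1-p)^(-i) when i vertices of the other colour
    have been visited, gives a martingale up to these m vertices. Its
    increments are sums over edges f of ([f open] - p) times a coefficient which
    does not depend on the weight of f, because the algorithm does not look at
    f before visiting an endpoint of f. Hence the increments are orthogonal and
    the total fluctuation is O(sqrt n), however small e is. So the proportions
    (b, w) of black and white vertices of S in V_n satisfy
      b = theta (1 - exp(-a w)) + O(e) + o(1),
      w = (1 - theta) (1 - exp(-a b)) + O(e) + o(1),  b + w >= e.
    As b |-> theta (1 - exp(-a (1 - theta)(1 - exp(-a b)))) / b is strictly
    decreasing, starting at lambda^2 > 1, this system forces (b, w) close to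
    (rho l, (1 - rho) l). Finally S is the set visited by Prim's algorithm at
    time |S| ~ l n, and the number of black vertices is 1-Lipschitz in time. *)

(** * Tables and the stopped run *)

(* All that Prim's algorithm and the percolation at level p see of the weights:
   [t.1 (e, f)] stands for [u e <= u f], and [t.2 e] for [e] being open. *)
Definition table (b w : nat) : finType :=
  ({ffun edge b w * edge b w -> bool} * {ffun edge b w -> bool})%type.

Section Run.
Context (b w : nat).
Local Notation V := (vertex b w).
Local Notation E := (edge b w).
Implicit Types (t : table b w) (S : {set V}) (e f : E) (v x : V) (c : bool).

Definition is_black v : bool := if v is inl _ then true else false.
Definition class c : {set V} := [set v | is_black v == c]%SET.
Definition tip c e : V := if c then inl e.1 else inr e.2.

Lemma tip_class c e : tip c e \in class c.
Proof. by case: c; rewrite inE. Qed.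

Lemma tip_classN c e : tip c e \notin class (~~ c).
Proof. by case: c; rewrite inE. Qed.

Lemma class_neq c v : (v \in class (~~ c)) = (v \notin class c).
Proof. by rewrite !inE; case: (is_black v); case: c. Qed.

Lemma crossingE c S e : crossing S e = ((tip c e \in S) != (tip (~~ c) e \in S)).
Proof. by case: c => //=; rewrite /crossing eq_sym. Qed.

Definition tprim_edge t S : option E :=
  [pick e | crossing S e & [forall f, crossing S f ==> t.1 (e, f)]].

(* Freezing at a set of size at least [m] which no open edge leaves: every vertex
   added to a set of size at least [m] is reached through an open edge. *)
Definition tstep m t S : {set V} :=
  if tprim_edge t S is Some e then
    if (m <= #|S|)%N && ~~ t.2 e then S else (outer_end S e |: S)%SET
  else S.

Definition trun m t v0 k : {set V} :=
  if k is k'.+1 then iter k' (tstep m t) [set v0]%SET else finset.set0.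

Lemma trunSS m t v0 k : trun m t v0 k.+2 = tstep m t (trun m t v0 k.+1).
Proof. by []. Qed.

Lemma outer_endP c S e : crossing S e ->
  outer_end S e \notin S /\
  ((outer_end S e = tip c e /\ tip (~~ c) e \in S) \/
   (outer_end S e = tip (~~ c) e /\ tip c e \in S)).
Proof.
rewrite /crossing /outer_end.
have [h1|h1] := boolP (inl e.1 \in S); have [h2|h2] := boolP (inr e.2 \in S) => // _.
  by split=> //; case: c => /=; [right|left].
by split=> //; case: c => /=; [left|right].
Qed.

Lemma tprim_edge_crossing t S e : tprim_edge t S = Some e -> crossing S e.
Proof. by rewrite /tprim_edge; case: pickP => // f /andP[cf _] [<-]. Qed.

Lemma trun_step m t v0 k : (0 < m)%N ->
  trun m t v0 k.+1 = trun m t v0 k \/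
  exists2 v, trun m t v0 k.+1 = (v |: trun m t v0 k)%SET &
    v \notin trun m t v0 k /\ ((#|trun m t v0 k| < m)%N \/
      exists e, [/\ crossing (trun m t v0 k) e,
                    v = outer_end (trun m t v0 k) e & t.2 e]).
Proof.
move=> m0; case: k => [|k].
  (* The start vertex counts among the first [m] vertices, which may be entered without an open
     edge. *)
  by right; exists v0; [rewrite finset.setU0|rewrite inE cards0; split=> //; left].
rewrite trunSS /tstep; case pe: tprim_edge => [e|]; last by left.
have ce := tprim_edge_crossing pe.
have [out _] := outer_endP true ce.
case: leqP => ms /=; last by right; exists (outer_end (trun m t v0 k.+1) e) => //; split=> //; left.
case te: (t.2 e) => /=; last by left.
by right; exists (outer_end (trun m t v0 k.+1) e) => //; split=> //; right; exists e.
Qed.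

Lemma trun_subS m t v0 k : (0 < m)%N -> trun m t v0 k \subset trun m t v0 k.+1.
Proof.
by move=> m0; have [->|[v -> _]] := trun_step t v0 k m0; rewrite ?subxx ?finset.subsetUr.
Qed.

Lemma trun_sub m t v0 j k : (0 < m)%N -> (j <= k)%N ->
  trun m t v0 j \subset trun m t v0 k.
Proof.
move=> m0 /subnK <-; elim: (k - j)%N => // i ih.
by rewrite addSn; apply: fintype.subset_trans ih (trun_subS _ _ _ m0).
Qed.

Definition hit c t S x : bool :=
  [exists e, [&& tip c e == x, tip (~~ c) e \in S & t.2 e]].

Lemma hitP c t S x :
  reflect (exists e, [/\ tip c e = x, tip (~~ c) e \in S & t.2 e]) (hit c t S x).
Proof.
apply: (iffP existsP) => [[e /and3P[/eqP h1 h2 h3]]|[e [h1 h2 h3]]]; exists e => //.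
by rewrite h1 h2 h3 eqxx.
Qed.

Lemma hitU1 c t S e : hit c t (tip (~~ c) e |: S)%SET (tip c e) =
  hit c t S (tip c e) || t.2 e.
Proof.
apply/hitP/orP => [[f [h1]]|[/hitP[f [h1 h2 h3]]|te]].
- rewrite !inE => /orP[/eqP h2 h3|h2 h3]; last by left; apply/hitP; exists f.
  right; suff -> : e = f by [].
  move: h1 h2; case: e f {h3} => [e1 e2] [f1 f2]; rewrite /tip.
  by case: c => /= -[->] [->].
- by exists f; rewrite !inE h2 orbT.
- by exists e; rewrite !inE eqxx.
Qed.

Lemma hitU1_same c t S v x : v \in class c ->
  hit c t (v |: S)%SET x = hit c t S x.
Proof.
move=> vc; apply: eq_existsb => e; rewrite !inE.
suff -> : (tip (~~ c) e == v) = false by [].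
by apply: contraTF vc => /eqP <-; rewrite -[c]negbK negbK tip_classN.
Qed.

(** * The compensated count of vertices not yet hit *)

Section Potential.
Context (R : realType) (Q : R) (c : bool).

Definition weight S : R := Q ^+ #|(S :&: class (~~ c))%SET|.

Definition pot t S : R :=
  \sum_(x in class c | (x \notin S) && ~~ hit c t S x) weight S.

(* Set at the visit of the end of [e] of colour [~~ c], before [e] is looked at. *)
Definition coef t S S' e : R :=
  ([&& tip (~~ c) e \in S', tip (~~ c) e \notin S, tip c e \notin S
     & ~~ hit c t S (tip c e)])%:R * weight S'.

(* Here [Q^-1] is the probability that an edge is closed. *)
Definition noise t e : R := (t.2 e)%:R - (1 - Q^-1).

Definition incr t S S' : R := \sum_e noise t e * coef t S S' e.

Lemma incr_id t S : incr t S S = 0.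
Proof.
by rewrite /incr big1 // => e _; rewrite /coef; case: (_ \in S); rewrite ?mul0r mulr0.
Qed.

Lemma big_class (F : V -> R) v : v \in class (~~ c) ->
  \sum_(x in class c) F x = \sum_(e | tip (~~ c) e == v) F (tip c e).
Proof.
move=> vc; have -> : class c = [set tip c e | e in [set e | tip (~~ c) e == v]]%SET.
  apply/setP => x; apply/idP/imsetP => [xc|[e _ ->]]; last exact: tip_class.
  move: vc xc; rewrite !inE /tip.
  by case: c; case: v => v; case: x => x //= _ _; [exists (x, v)|exists (v, x)]; rewrite ?inE //=.
rewrite big_imset /=; first by apply: eq_bigl => e; rewrite inE.
move=> [e1 e2] [f1 f2]; rewrite !inE /tip.
by case: c => /= /eqP <- /eqP [<-] [<-].
Qed.

(** The balance holds edge by edge. If the opposite end is unvisited and unhit, a closed edge leaves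
    [Q * weight S] and an open one leaves 0; adding noise times coefficient, that is [-(1 - Q^-1)]
    or [Q^-1] times [Q * weight S], gives [weight S] in both cases. *)
Lemma pot_other t S v : Q != 0 -> v \notin S -> v \in class (~~ c) ->
  pot t (v |: S)%SET + incr t S (v |: S)%SET = pot t S.
Proof.
move=> Q0 vS vc.
have wE : weight (v |: S)%SET = Q * weight S.
  have vI : ([set v] :&: class (~~ c) = [set v])%SET.
    by apply/finset.setIidPl; rewrite finset.sub1set.
  by rewrite /weight finset.setIUl vI cardsU1 inE (negbTE vS) exprS.
rewrite /pot !big_mkcondr !(big_class _ vc) /incr.
rewrite (bigID (fun e => tip (~~ c) e == v) predT) /=.
rewrite [X in _ + (_ + X)]big1 ?addr0 => [|e ev]; last first.
  rewrite /coef !inE (negbTE ev) /=; case: (_ \in S) => /=; by rewrite ?mul0r mulr0.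
rewrite -big_split /=; apply: eq_bigr => e /eqP ev.
rewrite -ev hitU1 /coef !inE eqxx /= ev vS /=.
have -> : (tip c e == v) = false by apply: contraTF vc => /eqP <-; rewrite tip_classN.
rewrite /= wE; case: (_ \in S) => /=; first by rewrite mul0r mulr0 addr0.
case: hit => /=; first by rewrite mul0r mulr0 addr0.
by rewrite /noise; case: (t.2 e) => /=; field.
Qed.

Lemma pot_same t S v : v \notin S -> v \in class c ->
  incr t S (v |: S)%SET = 0 /\
  pot t (v |: S)%SET = pot t S - (~~ hit c t S v)%:R * weight S.
Proof.
move=> vS vc; have vcn : v \notin class (~~ c) by rewrite class_neq negbK.
have wE : weight (v |: S)%SET = weight S.
  rewrite /weight; congr (_ ^+ #|pred_of_set _|); apply/setP => x; rewrite !inE.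
  by case: eqP => // ->; rewrite (negbTE vS); move: vcn; rewrite inE => /negbTE ->.
split.
  rewrite /incr big1 // => e _; rewrite /coef !inE.
  have -> : (tip (~~ c) e == v) = false.
    by apply: contraNF vcn => /eqP <-; rewrite tip_class.
  by case: (_ \in S); rewrite /= ?mul0r mulr0.
rewrite /pot !big_mkcondr /= (bigD1 v) //= [in RHS](bigD1 v) //=.
rewrite !inE eqxx vS /= add0r wE addrAC.
have -> : (if ~~ hit c t S v then weight S else 0) = (~~ hit c t S v)%:R * weight S.
  by case: ifP; rewrite ?mul1r ?mul0r.
rewrite subrr add0r; apply: eq_bigr => x /andP[xc xv].
by rewrite !inE (negbTE xv) hitU1_same.
Qed.

Definition mart m t v0 K : R :=
  \sum_(k < K) incr t (trun m t v0 k) (trun m t v0 k.+1).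

Lemma martS m t v0 K : mart m t v0 K.+1 =
  mart m t v0 K + incr t (trun m t v0 K) (trun m t v0 K.+1).
Proof. by rewrite /mart big_ord_recr. Qed.

Lemma weight_ge0 S : 1 <= Q -> 0 <= weight S.
Proof. by move=> Q1; rewrite exprn_ge0 // (le_trans ler01). Qed.

Lemma weight_le C S : 1 <= Q -> Q ^+ (b + w) <= C -> weight S <= C.
Proof.
move=> Q1; apply: le_trans; apply: ler_weXn2l => //.
by apply: leq_trans (max_card _) _; rewrite card_sum !card_ord.
Qed.

(** Visits of the other colour preserve the sum by [pot_other]. A visit of colour [c] through an
    open edge finds a vertex that is already hit and costs nothing; any other one costs at most one
    weight, hence at most [C], and occurs while fewer than [m] vertices are visited. *)
Lemma pot_bounds C m t v0 K : (0 < m)%N -> 1 <= Q -> Q ^+ (b + w) <= C ->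
  #|class c|%:R - C * (minn #|trun m t v0 K| m)%:R
    <= pot t (trun m t v0 K) + mart m t v0 K <= #|class c|%:R.
Proof.
move=> m0 Q1 QC; have Q0 : Q != 0 by rewrite gt_eqF // (lt_le_trans ltr01).
have C0 : 0 <= C by apply: le_trans QC; rewrite exprn_ge0 // (le_trans ler01).
elim: K => [|K ih].
  rewrite /mart big_ord0 addr0 cards0 min0n mulr0 subr0.
  suff -> : pot t finset.set0 = #|class c|%:R by rewrite lexx.
  rewrite /pot /weight finset.set0I cards0 expr0 sumr_const /=.
  congr _%:R; apply: eq_card => x; rewrite -[LHS]/(_ && _) !inE.
  rewrite andbC; case: hitP => [[e [_]]|_]; rewrite ?inE //=.
rewrite martS.
have [->|[v -> [vS hv]]] := trun_step t v0 K m0; first by rewrite incr_id addr0.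
set S := trun m t v0 K in ih vS hv *.
have cS : #|(v |: S)%SET| = #|S|.+1 by rewrite cardsU1 vS.
have mono : C * (minn #|S| m)%:R <= C * (minn #|S|.+1 m)%:R.
  by rewrite ler_wpM2l // ler_nat; lia.
have [vc|vc] := boolP (v \in class c); last first.
  have pe := pot_other t Q0 vS (_ : v \in class (~~ c)).
  rewrite class_neq in pe; have {}pe := pe vc.
  by rewrite cS; move: ih mono pe => /andP[]; lra.
have [-> ->] := pot_same t vS vc; rewrite cS addr0.
have w0 := weight_ge0 S Q1; have wC := weight_le S Q1 QC.
case: hv => [Sm|[e [ce ve te]]].
  have mE : (minn #|S|.+1 m)%:R = (minn #|S| m)%:R + 1 :> R.
    by rewrite natr1; congr _%:R; lia.
  rewrite mE mulrDr mulr1; case: hit => /=; rewrite ?mul0r ?mul1r; move: ih mono w0 wC C0 => /andP[]; lra.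
suff -> : hit c t S v by rewrite /= mul0r subr0; move: ih mono => /andP[]; lra.
apply/hitP; exists e; split => //.
  have [_ [[z1 z2]|[z1 z2]]] := outer_endP c ce; first by rewrite ve.
  by have := tip_classN (~~ c) e; rewrite negbK -z1 -ve vc.
have [_ [[//]|[z1 z2]]] := outer_endP c ce.
by have := tip_classN (~~ c) e; rewrite negbK -z1 -ve vc.
Qed.

End Potential.
End Run.

(** * The stopped run compared with Prim's algorithm *)

Section Terminal.
Context (R : realType) (b w : nat).
Local Notation V := (vertex b w).
Local Notation E := (edge b w).
Implicit Types (u : E -> R) (p : R) (S : {set V}) (e f : E) (v x : V) (c : bool).

Definition tab u p : table b w :=
  ([ffun ee => u ee.1 <= u ee.2], [ffun e => u e <= p]).

Lemma tprim_edge_tab u p S : tprim_edge (tab u p) S = prim_edge u S.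
Proof.
apply: eq_pick => e /=; congr (_ && _).
by apply: eq_forallb => f; rewrite ffunE.
Qed.

(** No set of vertices reaches size [b + w + 1], so with this threshold the run never freezes and is
    Prim's algorithm at every level [p]. *)
Lemma prim_setE u p v0 k : prim_set u v0 k = trun (b + w).+1 (tab u p) v0 k.
Proof.
case: k => //= k; elim: k => //= k ->; rewrite /prim_step /tstep tprim_edge_tab.
case: prim_edge => // e; case: leqP => //= h.
by have := leq_trans h (max_card _); rewrite card_sum !card_ord ltnn.
Qed.

Lemma trun_gt0 m (t : table b w) v0 k : (0 < m)%N -> v0 \in trun m t v0 k.+1.
Proof. by move=> m0; apply: (fintype.subsetP (trun_sub t v0 m0 (ltn0Sn k))); rewrite inE. Qed.

(** Each step either stays put or is a step of Prim's algorithm that adds one vertex, so the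
    cardinality is the time of Prim's algorithm. *)
Lemma trun_prim m u p v0 k : (0 < m)%N ->
  trun m (tab u p) v0 k = prim_set u v0 #|trun m (tab u p) v0 k|.
Proof.
move=> m0; case: k => [|k]; first by rewrite cards0.
elim: k => [|k ih]; first by rewrite /= cards1.
set t := tab u p in ih *; set S := trun m t v0 k.+1 in ih.
have S0 : (0 < #|S|)%N by apply/card_gt0P; exists v0; exact: trun_gt0.
have st : trun m t v0 k.+2 = S \/ trun m t v0 k.+2 = prim_step u S.
  rewrite trunSS -/S /tstep tprim_edge_tab /prim_step.
  by case: prim_edge => [e|]; [case: ifP => _; [left|right]|left].
have [-> //|[v e [vS _]]] := trun_step t v0 k.+1 m0.
have eS : #|trun m t v0 k.+2| = #|S|.+1 by rewrite e cardsU1 vS.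
case: st => [h|h].
  by move: eS; rewrite h => /eqP; rewrite -[X in X == _]addn0 -addn1 eqn_add2l.
rewrite eS h; move: ih S0; case: #|S| => // n ih _.
by rewrite [in LHS]ih.
Qed.

Lemma card_prim_set_lip u v0 (B : {set V}) j k : (j <= k)%N ->
  (#|prim_set u v0 j :&: B| <= #|prim_set u v0 k :&: B| <= #|prim_set u v0 j :&: B| + (k - j))%N%SET.
Proof.
move=> /subnK <-; rewrite addnK; elim: (k - j)%N => [|i ih]; first by rewrite addn0 leqnn.
move: ih; rewrite addSn !(prim_setE u 0).
have [->|[v -> _]] := trun_step (tab u 0) v0 (i + j) (ltn0Sn (b + w)).
  by move=> /andP[-> h]; rewrite (leq_trans h) // leq_add2l.
move=> /andP[h1 h2]; rewrite finset.setIUl; apply/andP; split.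
  by apply: leq_trans h1 _; apply: subset_leq_card; exact: finset.subsetUr.
apply: leq_trans (leq_card_setU _ _) _.
have : (#|[set v] :&: B| <= 1)%N%SET.
  by rewrite -(cards1 v); apply: subset_leq_card; exact: finset.subsetIl.
by move: h2; rewrite addnS; lia.
Qed.

(** Every step before the run becomes stationary adds a vertex, so after [b + w] steps it is
    stationary or has exhausted the graph. *)
Lemma trun_fixed m (t : table b w) v0 : (0 < m)%N ->
  tstep m t (trun m t v0 (b + w)) = trun m t v0 (b + w).
Proof.
move=> m0; have : (0 < b + w)%N by case: v0 => v; have := ltn_ord v; lia.
case eN: (b + w)%N => [//|N] _; rewrite -eN.
suff [h|h] : tstep m t (trun m t v0 N.+1) = trun m t v0 N.+1 \/ (N.+1 <= #|trun m t v0 N.+1|)%N.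
- by rewrite eN.
- have -> : trun m t v0 (b + w) = [set: V]%SET.
    apply/eqP; rewrite eqEcard finset.subsetT cardsT card_sum !card_ord eN.
    exact: h.
  rewrite /tstep; case pe: tprim_edge => [e|] //.
  by have := tprim_edge_crossing pe; rewrite /crossing !inE.
elim: N {eN} => [|N [ih|ih]]; first by right; rewrite /= cards1.
  by left; rewrite trunSS ih.
have [e|[v e [vS _]]] := trun_step t v0 N.+1 m0.
  by left; rewrite trunSS in e; rewrite trunSS !e.
by right; rewrite e cardsU1 vS.
Qed.

Lemma trun_closed m u p v0 : (0 < m)%N -> (m <= b + w)%N -> (0 < b)%N -> (0 < w)%N ->
  let S := trun m (tab u p) v0 (b + w) in
  (m <= #|S|)%N /\ forall e, crossing S e -> ~~ (tab u p).2 e.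
Proof.
move=> m0 mN b0 w0 S; have := trun_fixed (tab u p) v0 m0; rewrite -/S /tstep.
rewrite tprim_edge_tab.
have v0S : v0 \in S.
  have : (0 < b + w)%N by lia.
  by rewrite /S; case: (b + w)%N => // n _; exact: trun_gt0.
case pe: prim_edge => [e|].
  move: pe; rewrite -(tprim_edge_tab u p) => pe; have ce := tprim_edge_crossing pe.
  have [out _] := outer_endP true ce.
  (* The edge was refused, for taking it would enlarge [S]. It is closed and has the least weight
     among the crossing edges, so all of them are closed. *)
  case: ifP => [/andP[ms te] _|_ h]; last first.
    by move: out; have := finset.setU11 (outer_end S e) S; rewrite h => ->.
  split => // f cf; move: pe te; rewrite /tprim_edge; case: pickP => // e'.
  move=> /andP[_ /forallP/(_ f)]; rewrite cf !ffunE /= => le [<-].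
  by rewrite -!ltNge => /lt_le_trans; exact.
move=> _; have nc e : ~~ crossing S e.
  apply/negP => ce; move: pe; rewrite /prim_edge; case: pickP => // h _.
  have [e0 ce0 me0] := @Order.TotalTheory.arg_minP _ R _ e (crossing S) u ce.
  have := h e0; rewrite ce0 /= => /negP; apply; apply/forallP => f.
  by apply/implyP => cf; exact: me0.
split; last by move=> e ce; move: (nc e); rewrite ce.
have nE e : (tip true e \in S) = (tip false e \in S).
  by apply/eqP; move: (nc e); rewrite (crossingE true) negbK.
suff -> : S = [set: V]%SET by rewrite cardsT card_sum !card_ord.
apply/setP => x; rewrite finset.in_setT.
(* With both sides nonempty, a path of at most two edges leads from [v0] to any vertex. *)
clearbody S; case: v0 v0S {pe nc} => [i|j] vS; case: x => [i'|j'].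
- by have := nE (i', Ordinal w0); have := nE (i, Ordinal w0); rewrite /tip /= vS => <- ->.
- by have := nE (i, j'); rewrite /tip /= vS => <-.
- by have := nE (i', j); rewrite /tip /= vS => ->.
- by have := nE (Ordinal b0, j'); have := nE (Ordinal b0, j); rewrite /tip /= vS => -> <-.
Qed.
End Terminal.

(** * Second moment of the martingale *)

Section SecondMoment.
Context (b w : nat).
Local Notation V := (vertex b w).
Local Notation E := (edge b w).
Implicit Types (t : table b w) (S : {set V}) (e f : E) (v x : V) (c : bool).

(** A function of the table invariant under this relation does not look at the weight of [f]. *)
Definition agree_off f t t' : Prop :=
  (forall e e', e != f -> e' != f -> t.1 (e, e') = t'.1 (e, e')) /\
  (forall e, e != f -> t.2 e = t'.2 e).

Lemma agree_off_sym f t t' : agree_off f t t' -> agree_off f t' t.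
Proof. by case=> h1 h2; split=> [e e' *|e ef]; rewrite ?h1 ?h2. Qed.

(* As long as neither endpoint of [f] is visited, [f] is not a crossing edge; this
   includes the step at which the first endpoint is added. *)
Lemma trun_agree c m t t' v0 f l j : (0 < m)%N -> agree_off f t t' ->
  tip c f \notin trun m t v0 l -> tip (~~ c) f \notin trun m t v0 l ->
  (j <= l.+1)%N -> trun m t v0 j = trun m t' v0 j.
Proof.
move=> m0 [ag1 ag2] h1 h2; case: j => // j; elim: j => // j ih jl.
rewrite !trunSS -ih; last exact: ltnW.
set S := trun m t v0 j.+1.
have SS : S \subset trun m t v0 l by exact: trun_sub.
have nf : ~~ crossing S f.
  rewrite (crossingE c) negbK.
  by rewrite !(negbTE (contra (fintype.subsetP SS _) _)).
have ne e : crossing S e -> e != f by apply: contraTneq => ->.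
have pE : tprim_edge t S = tprim_edge t' S.
  apply: eq_pick => e /=; case ce: (crossing S e) => //=.
  apply: eq_forallb => e'; case ce': (crossing S e') => //=.
  by apply: ag1; exact: ne.
rewrite /tstep -pE; case pe: tprim_edge => [e|//].
by rewrite ag2 // ne // (tprim_edge_crossing pe).
Qed.

Section Moments.
Context (R : realType) (Q : R) (c : bool) (m : nat) (v0 : V).
Context (mu : table b w -> R).
Hypothesis m_gt0 : (0 < m)%N.
Hypothesis Q_ge1 : 1 <= Q.
Hypothesis mu_ge0 : forall t, 0 <= mu t.
Hypothesis mu_sum : \sum_t mu t = 1.
Hypothesis mu_indep : forall e (F : table b w -> R),
  (forall t t', agree_off e t t' -> F t = F t') ->
  \sum_t mu t * (noise Q t e * F t) = 0.

Local Notation S k t := (trun m t v0 k).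
Local Notation cf k t e := (coef Q c t (S k t) (S k.+1 t) e).

Lemma coef_neq0 t k e : cf k t e != 0 ->
  [/\ tip (~~ c) e \in S k.+1 t, tip (~~ c) e \notin S k t & tip c e \notin S k t].
Proof. by rewrite /coef; case: and4P => [[]|]; rewrite // mul0r eqxx. Qed.

(** The coefficients up to time [l] involve the run up to time [l + 1] and the edges at vertices
    visited by time [l]; [f] influences neither while both its ends are unvisited at time [l]. *)
Lemma coef_agree t t' k l e f : agree_off f t t' -> (k <= l)%N ->
  tip c f \notin S l t -> tip (~~ c) f \notin S l t -> cf k t e = cf k t' e.
Proof.
move=> ag kl h1 h2.
have eqS j := trun_agree (j := j) m_gt0 ag h1 h2.
rewrite -(eqS k); last exact: leqW.
rewrite -(eqS k.+1) //; rewrite /coef; congr ((_ && (_ && (_ && ~~ _)))%:R * _).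
apply: eq_existsb => g; have [->|gf] := eqVneq g f; last by rewrite (proj2 ag).
suff /negbTE -> : tip (~~ c) f \notin S k t by rewrite !andbF.
exact: contra (fintype.subsetP (trun_sub t v0 m_gt0 kl) _) h2.
Qed.

Lemma noise_agree f t t' e : agree_off f t t' -> e != f -> noise Q t e = noise Q t' e.
Proof. by move=> [_ ag] ef; rewrite /noise ag. Qed.

(** Where the coefficient of [f] at time [l] is nonzero, both ends of [f] are still unvisited, so
    the rest of the product ignores the weight of [f], whose noise is centred by [mu_indep]. *)
Lemma orthogonal_le k l e f : (k <= l)%N -> e != f ->
  \sum_t mu t * ((noise Q t e * cf k t e) * (noise Q t f * cf l t f)) = 0.
Proof.
move=> kl ef; have := mu_indep (e := f)
  (F := fun t => noise Q t e * cf k t e * cf l t f).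
have key t t' : agree_off f t t' -> cf l t f != 0 ->
    noise Q t e * cf k t e * cf l t f = noise Q t' e * cf k t' e * cf l t' f.
  move=> ag /coef_neq0[_ h2 h1].
  by rewrite (noise_agree ag ef) (coef_agree e ag kl h1 h2) (coef_agree f ag (leqnn l) h1 h2).
(* [key] starts from a nonzero coefficient; if it is nonzero for [t'] only, the tables are
   exchanged. *)
have indep t t' : agree_off f t t' ->
    noise Q t e * cf k t e * cf l t f = noise Q t' e * cf k t' e * cf l t' f.
  move=> ag; have [z|] := eqVneq (cf l t f) 0; last exact: key.
  have [z'|nz'] := eqVneq (cf l t' f) 0; first by rewrite z z' !mulr0.
  by apply/esym; apply: key => //; exact: agree_off_sym.
move=> /(_ indep) h; rewrite -[RHS]h; apply: eq_bigr => t _; ring.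
Qed.

Lemma orthogonal k l e f : (k, e) != (l, f) ->
  \sum_t mu t * ((noise Q t e * cf k t e) * (noise Q t f * cf l t f)) = 0.
Proof.
have [<-|ef _] := eqVneq e f; last first.
  have [kl|/ltnW lk] := leqP k l; first exact: orthogonal_le.
  rewrite -[RHS](orthogonal_le lk (_ : f != e)) 1?eq_sym //.
  by apply: eq_bigr => t _; congr (_ * _); rewrite mulrC.
wlog kl : k l / (k < l)%N => [hw|_].
  rewrite xpair_eqE eqxx andbT => kl.
  have [lt|gt|eq] := ltngtP k l; last by rewrite eq eqxx in kl.
    by apply: hw => //; rewrite xpair_eqE eqxx andbT.
  under eq_bigr do rewrite [X in _ * X]mulrC.
  by apply: hw => //; rewrite xpair_eqE eqxx andbT eq_sym.
(* The same edge at two times: its end of colour [~~ c] is added only once, so one of the two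
   coefficients is zero. *)
rewrite big1 // => t _.
have [->|/coef_neq0[h1 h2 _]] := eqVneq (cf k t e) 0; first by rewrite mulr0 mul0r mulr0.
have [->|/coef_neq0[_ h3 _]] := eqVneq (cf l t e) 0; first by rewrite !mulr0.
by case/negP: h3; apply: (fintype.subsetP (trun_sub t v0 m_gt0 kl)).
Qed.

(** The noise takes the values [1 - p] and [-p], so its square is [p * (1 - p)] plus [1 - 2 * p]
    times the noise, and the latter term is centred. *)
Lemma noise_sqr_mean e (F : table b w -> R) :
  (forall t t', agree_off e t t' -> F t = F t') ->
  \sum_t mu t * (noise Q t e ^+ 2 * F t) =
  (1 - Q^-1) * Q^-1 * \sum_t mu t * F t.
Proof.
move=> indep; set p := 1 - Q^-1.
rewrite -[RHS]add0r -[X in X + _](mulr0 (1 - 2 * p)) -[X in _ * X + _](mu_indep indep).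
rewrite !big_distrr -big_split /=.
apply: eq_bigr => t _; rewrite /noise -/p (_ : Q^-1 = 1 - p); last by rewrite /p; ring.
by case: (t.2 e) => /=; ring.
Qed.

(** An edge contributes at most once, at the visit of its end of colour [~~ c]; the visit indicators
    telescope. *)
Lemma coef_sum_le C t e K : Q ^+ (b + w) <= C -> \sum_(k < K) cf k t e ^+ 2 <= C ^+ 2.
Proof.
move=> QC; pose i k : R := (tip (~~ c) e \in S k t)%:R.
have C0 : 0 <= C by apply: le_trans QC; rewrite exprn_ge0 // (le_trans ler01).
have step k : cf k t e ^+ 2 <= C ^+ 2 * (i k.+1 - i k).
  have sub := fintype.subsetP (trun_subS t v0 k m_gt0) (tip (~~ c) e).
  have [->|/[dup] nz /coef_neq0[h1 h2 _]] := eqVneq (cf k t e) 0.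
    rewrite expr0n /= mulr_ge0 ?sqr_ge0 // subr_ge0 /i ler_nat.
    by case: (_ \in S k t) sub => // ->.
  rewrite /i h1 (negbTE h2) subr0 mulr1 ler_sqr ?nnegrE //.
    by rewrite /coef; case: and4P => _; rewrite ?mul1r ?mul0r // weight_le.
  by rewrite /coef mulr_ge0 // weight_ge0.
apply: (le_trans (ler_sum _ (fun k _ => step (nat_of_ord k)))).
rewrite -mulr_sumr ler_piMr ?sqr_ge0 // -(big_mkord xpredT (fun k => i k.+1 - i k)).
rewrite telescope_sumr // /i [X in _ - X]/= inE subr0.
by case: (_ \in _).
Qed.

(** By orthogonality only the diagonal of the square survives. Each edge then contributes at most
    [1 - Q^-1], a bound for the variance of its noise, times [C ^+ 2]. *)
Lemma mart_sqr_mean C K : Q ^+ (b + w) <= C ->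
  \sum_t mu t * mart Q c m t v0 K ^+ 2 <= (1 - Q^-1) * C ^+ 2 * (b * w)%:R.
Proof.
move=> QC; have Q0 : 0 < Q := lt_le_trans ltr01 Q_ge1.
have Qi : 0 <= Q^-1 <= 1 by rewrite invr_ge0 ltW //= invf_le1.
pose X t (i : 'I_K * E) := noise Q t i.2 * cf i.1 t i.2.
have mE t : mart Q c m t v0 K = \sum_i X t i.
  by rewrite /mart /incr pair_big.
have -> : \sum_t mu t * mart Q c m t v0 K ^+ 2 =
    \sum_(i : 'I_K * E) \sum_t mu t * (noise Q t i.2 ^+ 2 * cf i.1 t i.2 ^+ 2) :> R.
  transitivity (\sum_(i : 'I_K * E) \sum_(j : 'I_K * E) \sum_t mu t * (X t i * X t j)).
    rewrite [RHS](eq_bigr (fun i => \sum_t \sum_j mu t * (X t i * X t j))); last first.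
      by move=> i _; rewrite exchange_big.
    rewrite exchange_big /=; apply: eq_bigr => t _.
    rewrite mE expr2 big_distrlr big_distrr /=; apply: eq_bigr => i _.
    by rewrite big_distrr.
  apply: eq_bigr => i _; rewrite (bigD1 i) //= [X in _ + X]big1 ?addr0.
    by apply: eq_bigr => t _; rewrite /X -expr2 exprMn.
  move=> [l f] ji; apply: orthogonal.
  by apply: contra_neq ji => -[kl <-]; case: i kl => k e /= /val_inj ->.
have sq (i : 'I_K * E) : \sum_t mu t * (noise Q t i.2 ^+ 2 * cf i.1 t i.2 ^+ 2)
    <= (1 - Q^-1) * \sum_t mu t * cf i.1 t i.2 ^+ 2.
  rewrite noise_sqr_mean => [|t t' ag]; last first.
    case: i => k f in ag *; rewrite /= in ag *.
    have [z|/coef_neq0[_ h2 h1]] := eqVneq (cf k t f) 0; last first.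
      by rewrite (coef_agree f ag (leqnn k) h1 h2).
    have [z'|/coef_neq0[_ h2 h1]] := eqVneq (cf k t' f) 0; first by rewrite z z'.
    by rewrite (coef_agree f (agree_off_sym ag) (leqnn k) h1 h2).
  rewrite -mulrA ler_wpM2l ?subr_ge0 ?(andP Qi).2 // ler_piMl ?(andP Qi).2 //.
  by apply: sumr_ge0 => t _; rewrite mulr_ge0 // sqr_ge0.
apply: (le_trans (ler_sum _ (fun i _ => sq i))).
rewrite -mulr_sumr -mulrA ler_wpM2l ?subr_ge0 ?(andP Qi).2 //.
rewrite (eq_bigr (fun i : 'I_K * E => (fun k e => \sum_t mu t * cf (nat_of_ord k) t e ^+ 2) i.1 i.2)) //.
rewrite -(pair_bigA _ (fun (k : 'I_K) e => \sum_t mu t * cf (nat_of_ord k) t e ^+ 2)) /=.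
rewrite exchange_big /=.
have le e : \sum_(k < K) \sum_t mu t * cf k t e ^+ 2 <= C ^+ 2.
  rewrite exchange_big /=; under eq_bigr do rewrite -mulr_sumr.
  apply: (@le_trans _ _ (\sum_t mu t * C ^+ 2)); last by rewrite -mulr_suml mu_sum mul1r.
  by apply: ler_sum => t _; rewrite ler_wpM2l // coef_sum_le.
apply: (le_trans (ler_sum _ (fun e _ => le e))).
have cE : #|E| = (b * w)%N by rewrite card_prod !card_ord.
rewrite sumr_const mulr_natr -cE; exact: lexx.
Qed.

(** Chebyshev's inequality. *)
Lemma mart_tail C K h : Q ^+ (b + w) <= C -> 0 < h ->
  \sum_(t | h < `|mart Q c m t v0 K|) mu t <=
  (1 - Q^-1) * C ^+ 2 * (b * w)%:R / h ^+ 2.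
Proof.
move=> QC h0; rewrite ler_pdivlMr ?exprn_gt0 // mulr_suml.
apply: le_trans (mart_sqr_mean K QC); rewrite big_mkcond /=.
apply: ler_sum => t _; case: ifP => [hm|_]; last by rewrite mulr_ge0 // sqr_ge0.
apply: ler_wpM2l => //; rewrite -[leRHS]real_normK ?num_real //.
by rewrite ler_sqr ?nnegrE ?normr_ge0 // ltW.
Qed.

End Moments.
End SecondMoment.

Local Open Scope classical_set_scope.
Local Open Scope ring_scope.

(** * The limiting system *)

Section Analysis.
Context {R : realType}.
Implicit Types (a s t th b w lambda theta : R).

Definition hitp t : R := 1 - expR (- t).

Lemma hitp_lt1 t : hitp t < 1.
Proof. by rewrite /hitp gtrBl expR_gt0. Qed.

Lemma hitp_gt0 t : 0 < t -> 0 < hitp t.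
Proof. by move=> t0; rewrite /hitp subr_gt0 expR_lt1 oppr_lt0. Qed.

Lemma hitp_ge0 t : 0 <= t -> 0 <= hitp t.
Proof. by move=> t0; rewrite /hitp subr_ge0 expR_le1 oppr_le0. Qed.

Lemma hitp_lt s t : s < t -> hitp s < hitp t.
Proof. by move=> st; rewrite /hitp ltrD2l ltrN2 ltr_expR ltrN2. Qed.

Lemma hitp_le s t : s <= t -> hitp s <= hitp t.
Proof. by move=> st; rewrite /hitp lerD2l lerN2 ler_expR lerN2. Qed.

Lemma hitp_leid t : hitp t <= t.
Proof. by have := expR_ge1Dx (- t); rewrite /hitp; lra. Qed.

Lemma hitp_lipschitz s t : 0 <= s -> s <= t -> hitp t - hitp s <= t - s.
Proof.
move=> s0 st; have -> : hitp t - hitp s = expR (- s) * hitp (t - s).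
  rewrite /hitp mulrBr mulr1 -expRD (_ : - s + - (t - s) = - t); ring.
have e1 : expR (- s) <= 1 by rewrite expR_le1 oppr_le0.
apply: le_trans (hitp_leid (t - s)).
by rewrite ler_piMl // hitp_ge0 // subr_ge0.
Qed.

Lemma hitp_ge t : 0 <= t -> t / (1 + t) <= hitp t.
Proof.
move=> t0; have t1 : 0 < 1 + t by lra.
have -> : t / (1 + t) = 1 - (1 + t)^-1 by field; rewrite gt_eqF.
rewrite /hitp expRN lerD2l lerN2 lef_pV2 ?posrE ?expR_gt0 //.
exact: expR_ge1Dx.
Qed.

(** Strict concavity of [hitp], which vanishes at 0. With [t = s + h] the claim reduces to
    [s * expR (- s) * hitp h < h * hitp s], a consequence of [1 + x < expR x] for nonzero [x]. *)
Lemma hitp_ratio s t : 0 < s -> s < t -> s * hitp t < t * hitp s.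
Proof.
move=> s0 st; set h := t - s; have h0 : 0 < h by rewrite subr_gt0.
have tE : t = s + h by rewrite /h; ring.
have Et : expR (- t) = expR (- s) * expR (- h).
  by rewrite -expRD tE; congr expR; ring.
rewrite /hitp Et.
have eh : 1 - h < expR (- h) by apply: expR_gt1Dx; rewrite oppr_eq0 gt_eqF.
have es : 1 + s < expR s by apply: expR_gt1Dx; rewrite gt_eqF.
have ess : expR s * expR (- s) = 1 by rewrite -expRD subrr expR0.
have p0 := expR_gt0 (- s).
have : (1 + s) * expR (- s) < 1 by rewrite -[ltRHS]ess ltr_pM2r.
move: (expR (- s)) (expR (- h)) p0 eh => x y p0 eh h1.
rewrite tE; have : s * x * (1 - y) < s * x * h by rewrite ltr_pM2l ?mulr_gt0 //; lra.
have : h * (s * x) < h * (1 - x) by rewrite ltr_pM2l //; lra.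
nra.
Qed.

Lemma continuous_hitp : continuous hitp.
Proof.
move=> x; rewrite /hitp; apply: cvgB; first exact: cvg_cst.
by apply: (@continuous_comp _ _ _ (-%R) expR); [exact: opp_continuous|exact: continuous_expR].
Qed.

(* The fixed points [b] of [gen a th1 th2] are the black masses of the solutions
   of the system, the white mass being [th2 * hitp (a * b)]. *)
Definition gen a th1 th2 b : R := th1 * hitp (a * (th2 * hitp (a * b))).

(** Up to a constant, [gen b / b] is the product of [hitp x / x] at [x = a * th2 * hitp (a * b)] and
    [hitp y / y] at [y = a * b]; both decrease as [b] grows. *)
Lemma gen_ratio a th1 th2 b1 b2 : 0 < a -> 0 < th1 -> 0 < th2 ->
  0 < b1 -> b1 < b2 -> b1 * gen a th1 th2 b2 < b2 * gen a th1 th2 b1.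
Proof.
move=> a0 t10 t20 b0 b12; rewrite /gen.
have y1 : 0 < a * b1 by rewrite mulr_gt0.
have y12 : a * b1 < a * b2 by rewrite ltr_pM2l.
have g1 := hitp_gt0 y1; have g12 := hitp_lt y12.
have r1 := hitp_ratio y1 y12.
set x1 := a * (th2 * hitp (a * b1)); set x2 := a * (th2 * hitp (a * b2)).
have x10 : 0 < x1 by rewrite /x1 !mulr_gt0.
have x12 : x1 < x2 by rewrite /x1 /x2 !ltr_pM2l.
have r2 := hitp_ratio x10 x12.
have gx := hitp_gt0 x10.
have {}r2 : hitp (a * b1) * hitp x2 < hitp (a * b2) * hitp x1.
  have at0 : 0 < a * th2 by rewrite mulr_gt0.
  rewrite -(ltr_pM2l at0); have -> : a * th2 * (hitp (a * b1) * hitp x2) = x1 * hitp x2.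
    by rewrite /x1; ring.
  by have -> : a * th2 * (hitp (a * b2) * hitp x1) = x2 * hitp x1 by rewrite /x2; ring.
rewrite mulrCA [ltRHS]mulrCA ltr_pM2l //.
have {}r1 : b1 * hitp (a * b2) < b2 * hitp (a * b1).
  by rewrite -(ltr_pM2l a0) !mulrA.
rewrite -(ltr_pM2l g1) mulrCA.
apply: (@lt_trans _ _ (b1 * (hitp (a * b2) * hitp x1))); first by rewrite ltr_pM2l.
by rewrite mulrA [ltRHS]mulrA [hitp _ * b2]mulrC ltr_pM2r.
Qed.


Lemma gen_lt a a' (th1 th2 b : R) : 0 < a -> a < a' -> 0 < th1 -> 0 < th2 ->
  0 < b -> gen a th1 th2 b < gen a' th1 th2 b.
Proof.
move=> a0 aa t10 t20 b0; rewrite /gen ltr_pM2l //; apply: hitp_lt.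
have gl : hitp (a * b) < hitp (a' * b) by apply: hitp_lt; rewrite ltr_pM2r.
have g0 : 0 < hitp (a * b) by rewrite hitp_gt0 // mulr_gt0.
by apply: ltr_pM => //; rewrite ?ltW ?mulr_gt0 // ltr_pM2l.
Qed.

(** The system in the masses [b = rho * ell] and [w = (1 - rho) * ell], with [a = alpha * lambda];
    in this form it is symmetric in the two colours. *)
Definition balanced a (th1 th2 b w : R) : Prop :=
  [/\ 0 < b, 0 < w, b = th1 * hitp (a * w) & w = th2 * hitp (a * b)].

Lemma balanced_sym a (th1 th2 b w : R) :
  balanced a th1 th2 b w -> balanced a th2 th1 w b.
Proof. by case. Qed.

Lemma balanced_gen a (th1 th2 b w : R) :
  balanced a th1 th2 b w -> gen a th1 th2 b = b.
Proof. by case=> _ _ eb ew; rewrite /gen -ew -eb. Qed.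

(** The ratio of [gen] with parameter [a'] to its argument exceeds 1 at [b] and equals 1 at [b']; as
    it decreases, [b < b']. *)
Lemma balanced_lt a a' (th1 th2 b w b' w' : R) : 0 < a -> a < a' ->
  0 < th1 -> 0 < th2 -> balanced a th1 th2 b w -> balanced a' th1 th2 b' w' ->
  b < b'.
Proof.
move=> a0 aa t10 t20 s s'; have a'0 := lt_trans a0 aa.
have [b0 _ _ _] := s; have [b'0 _ _ _] := s'.
have := gen_lt a0 aa t10 t20 b0; rewrite (balanced_gen s).
have [//|b'b|bb'] := ltgtP b b'; last by rewrite bb' (balanced_gen s') ltxx.
have := gen_ratio a'0 t10 t20 b'0 b'b; rewrite (balanced_gen s') mulrC.
by rewrite ltr_pM2r // => /lt_trans h /h; rewrite ltxx.
Qed.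

Lemma balanced_uniq_fst a (th1 th2 b w b' w' : R) : 0 < a ->
  0 < th1 -> 0 < th2 -> balanced a th1 th2 b w -> balanced a th1 th2 b' w' ->
  b = b'.
Proof.
move=> a0 t10 t20 s s'; wlog bb : b w b' w' s s' / b < b' => [hw|].
  have [bb|bb|//] := ltgtP b b'; first exact: (hw b w b' w').
  by apply/esym; apply: (hw b' w' b w).
have [b0 _ _ _] := s.
have := gen_ratio a0 t10 t20 b0 bb.
by rewrite (balanced_gen s) (balanced_gen s') mulrC ltxx.
Qed.

(** Intermediate value theorem for [gen b - b], which is nonpositive at [th1] and nonnegative at a
    small [d] because the slope of [gen] at 0 is [L > 1]. *)
Lemma balanced_exists a (th1 th2 : R) : 0 < a -> 0 < th1 -> 0 < th2 ->
  1 < a ^+ 2 * (th1 * th2) -> exists b w, balanced a th1 th2 b w.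
Proof.
move=> a0 t10 t20 sup; set L := a ^+ 2 * (th1 * th2) in sup.
(* Two uses of [hitp t >= t / (1 + t)] give [gen d >= d * L / (1 + k * d)], which is at least [d]
   once [k * d <= L - 1]. *)
set k := a + a ^+ 2 * th2.
have k0 : 0 < k by rewrite addr_gt0 // mulr_gt0 // exprn_gt0.
pose d := Num.min th1 ((L - 1) / k).
have d0 : 0 < d by rewrite lt_min t10 divr_gt0 // subr_gt0.
have dt : d <= th1 by rewrite ge_min lexx.
have dk : k * d <= L - 1.
  by rewrite mulrC -ler_pdivlMr // ge_min lexx orbT.
have gd : d <= gen a th1 th2 d.
  have y0 : 0 < a * d by rewrite mulr_gt0.
  have h1 := hitp_ge (ltW y0).
  set v := a * th2 * ((a * d) / (1 + a * d)).
  have v0 : 0 < v by rewrite /v !mulr_gt0 ?invr_gt0 //; lra.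
  have h2 : hitp v <= hitp (a * (th2 * hitp (a * d))).
    by apply: hitp_le; rewrite /v -mulrA !ler_pM2l.
  apply: (@le_trans _ _ (th1 * (v / (1 + v)))); last first.
    by rewrite /gen ler_pM2l //; apply: le_trans h2; exact/hitp_ge/ltW.
  have z0 : 0 < a * a * th2 * d by rewrite !mulr_gt0.
  have -> : th1 * (v / (1 + v)) = d * (L / (1 + k * d)).
    by rewrite /v /L /k; field; do ?[apply/andP; split]; rewrite gt_eqF //; lra.
  by apply: ler_peMr; [exact: ltW|rewrite ler_pdivlMr; nra].
have gt : gen a th1 th2 th1 <= th1.
  by apply: ler_piMr; rewrite ltW ?hitp_lt1.
pose f b := gen a th1 th2 b - b.
have cf : {within `[d, th1], continuous f}.
  apply: continuous_subspaceT => x; apply: cvgB; last exact: cvg_id.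
  apply: cvgMl_tmp; apply: continuous_cvg; first exact: continuous_hitp.
  apply: cvgMl_tmp; apply: cvgMl_tmp; apply: continuous_cvg.
    exact: continuous_hitp.
  by apply: cvgMl_tmp; exact: cvg_id.
have [|b bd fb] := IVT (v := 0) dt cf.
  by rewrite ge_min le_max /f !subr_le0 !subr_ge0 gd gt orbT.
have b0 : 0 < b by move: bd; rewrite in_itv /= => /andP[] /(lt_le_trans d0).
exists b, (th2 * hitp (a * b)); split => //.
  by rewrite mulr_gt0 // hitp_gt0 // mulr_gt0.
by apply/esym/eqP; rewrite -subr_eq0; apply/eqP.
Qed.

(** * Stability of the solution under perturbation *)

Lemma hitp_perturb s t e : 0 <= s -> 0 <= e -> t <= s + e -> hitp t <= hitp s + e.
Proof.
move=> s0 e0 te; have [ts|/ltW st] := leP t s.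
  by apply: (le_trans (hitp_le ts)); rewrite lerDl.
by have := hitp_lipschitz s0 st; lra.
Qed.

(** Eliminating [w] gives [gen b <= b + C * eta] and [b <= gen b + C * (K * eps + eta)]. Above
    [b0 + kappa] the gap [b - gen b] is bounded below, so an error of order [eps] is harmless. Below
    [b0 - kappa] the gap [gen b - b] may be as small as a multiple of [b], hence of [eps]; there
    only the error [eta] enters, and it is chosen after [eps]. *)
Lemma balanced_stable_fst a (th1 th2 b0 w0 K kappa : R) : 0 < a ->
  0 < th1 -> 0 < th2 -> 0 < K -> 0 < kappa -> balanced a th1 th2 b0 w0 ->
  exists2 eps0, 0 < eps0 & forall eps, 0 < eps -> eps <= eps0 ->
  exists2 eta0, 0 < eta0 & forall eta b w, 0 < eta -> eta <= eta0 ->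
    0 <= b -> 0 <= w -> eps <= b + w ->
    th1 * hitp (a * w) - eta <= b <= th1 * hitp (a * w) + (K * eps + eta) ->
    th2 * hitp (a * b) - eta <= w <= th2 * hitp (a * b) + (K * eps + eta) ->
    `|b - b0| <= kappa.
Proof.
move=> a0 t10 t20 K0 k0 s; have [b00 _ _ _] := s.
pose C := 1 + th1 * a; have C0 : 0 < C by rewrite /C addr_gt0 // mulr_gt0.
pose b2 := b0 + kappa; have b20 : 0 < b2 by rewrite addr_gt0.
have g2 : gen a th1 th2 b2 < b2.
  have b02 : b0 < b2 by rewrite ltrDl.
  have := gen_ratio a0 t10 t20 b00 b02.
  by rewrite (balanced_gen s) [ltRHS]mulrC ltr_pM2l.
(* With [K * eps <= g] and [eta <= g / 2] the upper error is at most three quarters of the gap at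
   [b2]. *)
pose g := (b2 - gen a th1 th2 b2) / (2 * C).
have gg0 : 0 < g by rewrite divr_gt0 ?mulr_gt0 // subr_gt0.
have gE : C * (g + g / 2) = (b2 - gen a th1 th2 b2) * (3 / 4).
  by rewrite /g; field; rewrite gt_eqF.
clearbody g; exists (g / K); first by rewrite divr_gt0.
move=> eps e0; rewrite ler_pdivlMr // mulrC => eg.
(* As [b + w >= eps], either [b >= eps / 2], or [w >= eps / 2] and then
   [b >= th1 * hitp (a * (eps / 2)) - eta]. Hence [b >= low / 2]. *)
pose low := Num.min (eps / 2) (th1 * hitp (a * (eps / 2))).
have low0 : 0 < low.
  by rewrite lt_min divr_gt0 //= mulr_gt0 // hitp_gt0 // mulr_gt0 // divr_gt0.
have low_eps : low <= eps / 2 by rewrite ge_min lexx.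
have low_hit : low <= th1 * hitp (a * (eps / 2)) by rewrite ge_min lexx orbT.
clearbody low; pose b1 := b0 - kappa.
(* The value 1 is a default: for [b1 <= 0] no positive [b] lies below [b1]. *)
pose g1 := if 0 < b1 then (low / 2) * (gen a th1 th2 b1 - b1) / (2 * (b1 * C)) else 1.
have gb1 : 0 < b1 -> b1 < gen a th1 th2 b1.
  move=> b10; have b1b0 : b1 < b0 by rewrite /b1; lra.
  have := gen_ratio a0 t10 t20 b10 b1b0.
  by rewrite (balanced_gen s) mulrC ltr_pM2l.
have g10 : 0 < g1.
  rewrite /g1; case: ifP => // b10.
  by rewrite divr_gt0 ?mulr_gt0 // ?divr_gt0 // subr_gt0 gb1.
have g1E : 0 < b1 -> g1 * (2 * (b1 * C)) = low / 2 * (gen a th1 th2 b1 - b1).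
  by rewrite /g1 => b10; rewrite b10 divfK // gt_eqF // !mulr_gt0.
clearbody g1; exists (Num.min (low / 2) (Num.min (g / 2) g1)).
  by rewrite !lt_min g10 andbT; apply/andP; split; apply: divr_gt0.
move=> eta b w h0; rewrite !le_min => /and3P[hl hg h1] bp wp ebw.
move=> /andP[bl bu] /andP[wl wu].
have lowb : low / 2 <= b.
  have [hb|hb] := leP (eps / 2) b.
    by move: low_eps hb low0; clear; lra.
  have hw : eps / 2 <= w by move: ebw hb; clear; lra.
  have : th1 * hitp (a * (eps / 2)) <= th1 * hitp (a * w).
    by rewrite ler_pM2l //; apply: hitp_le; rewrite ler_pM2l.
  by move: low_hit bl hl; clear; lra.
have bpos : 0 < b by move: lowb low0; clear; lra.
have hab0 : 0 <= a * (th2 * hitp (a * b)).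
  by rewrite !mulr_ge0 ?ltW // hitp_gt0 // mulr_gt0.
have upper : b <= gen a th1 th2 b + C * (K * eps + eta).
  have dp : 0 <= K * eps + eta by rewrite addr_ge0 ?ltW // mulr_gt0.
  have : hitp (a * w) <= hitp (a * (th2 * hitp (a * b))) + a * (K * eps + eta).
    apply: hitp_perturb => //; first by rewrite mulr_ge0 // ltW.
    by rewrite -mulrDr ler_pM2l.
  move/(ler_wpM2l (ltW t10)) => hh; apply: (le_trans bu).
  rewrite /C mulrDl mul1r [X in _ <= _ + X]addrC [leRHS]addrA lerD2r.
  by apply: (le_trans hh); rewrite [leLHS]mulrDr /gen lerD2l mulrA.
have lower : gen a th1 th2 b <= b + C * eta.
  have : hitp (a * (th2 * hitp (a * b))) <= hitp (a * w) + a * eta.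
    have ae : 0 <= a * eta by rewrite ltW // mulr_gt0.
    apply: hitp_perturb => //; first by rewrite mulr_ge0 // ltW.
    by rewrite -mulrDr ler_pM2l // -lerBlDr.
  move/(ler_wpM2l (ltW t10)) => hh; apply: (le_trans hh).
  by rewrite [leLHS]mulrDr /C mulrDl mul1r [leRHS]addrA mulrA lerD2r -lerBlDr.
rewrite ler_norml; apply/andP; split; rewrite leNgt; apply/negP => hb.
  have bb1 : b < b1 by rewrite /b1; move: hb; clear; lra.
  have b10 := lt_trans bpos bb1.
  have r := gen_ratio a0 t10 t20 bpos bb1; have gb := gb1 b10.
  have x0 : eta * (2 * (b1 * C)) <= low / 2 * (gen a th1 th2 b1 - b1).
    by rewrite -g1E // ler_pM2r // !mulr_gt0.
  have x1 : b1 * gen a th1 th2 b <= b1 * (b + C * eta) by rewrite ler_pM2l.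
  have x2 : low / 2 * (gen a th1 th2 b1 - b1) <= b * (gen a th1 th2 b1 - b1).
    by rewrite ler_pM2r // subr_gt0.
  have x3 : 0 < b1 * C * eta by rewrite !mulr_gt0.
  by move: r x0 x1 x2 x3; clear; lra.
have bb2 : b2 < b by rewrite /b2; move: hb; clear; lra.
have r := gen_ratio a0 t10 t20 b20 bb2.
have x1 : C * (K * eps + eta) <= C * (g + g / 2).
  by rewrite ler_pM2l //; move: eg hg; clear; lra.
have x2 : b2 * (b2 - gen a th1 th2 b2) < b * (b2 - gen a th1 th2 b2).
  by rewrite ltr_pM2r // subr_gt0.
have x4 : b2 * (b2 - gen a th1 th2 b2) < b2 * (b - gen a th1 th2 b).
  by move: r x2; clear; lra.
move: x4; rewrite ltr_pM2l //; move: x1 upper; rewrite gE.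
by move: g2; clear; lra.
Qed.

Lemma balanced_stable a (th1 th2 b0 w0 K kappa : R) : 0 < a ->
  0 < th1 -> 0 < th2 -> 0 < K -> 0 < kappa -> balanced a th1 th2 b0 w0 ->
  exists2 eps0, 0 < eps0 & forall eps, 0 < eps -> eps <= eps0 ->
  exists2 eta, 0 < eta & forall b w,
    0 <= b -> 0 <= w -> eps <= b + w ->
    th1 * hitp (a * w) - eta <= b <= th1 * hitp (a * w) + (K * eps + eta) ->
    th2 * hitp (a * b) - eta <= w <= th2 * hitp (a * b) + (K * eps + eta) ->
    `|b - b0| <= kappa /\ `|w - w0| <= kappa.
Proof.
move=> a0 t10 t20 K0 k0 s.
have [e1 e10 h1] := balanced_stable_fst a0 t10 t20 K0 k0 s.
have [e2 e20 h2] := balanced_stable_fst a0 t20 t10 K0 k0 (balanced_sym s).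
exists (Num.min e1 e2) => [|eps e0]; first by rewrite lt_min e10.
rewrite le_min => /andP[le1 le2].
have [d1 d10 {}h1] := h1 _ e0 le1; have [d2 d20 {}h2] := h2 _ e0 le2.
have m0 : 0 < Num.min d1 d2 by rewrite lt_min d10.
exists (Num.min d1 d2) => // b w bp wp bw hb hw; split.
  by apply: (h1 (Num.min d1 d2) b w) => //; rewrite ge_min lexx.
by apply: (h2 (Num.min d1 d2) w b) => //; rewrite 1?addrC // ge_min lexx orbT.
Qed.

(** * Solutions with prescribed total mass *)

Definition entropy t : R := - ln t * (1 - t).

(** One end of a segment of pairs [(x, y)]; exchanging the colours gives the other end, with the
    reverse inequality. If [s < th1], take [y = 1], where [entropy] vanishes; otherwise take [x]
    near 0, where it blows up. *)
Lemma entropy_endpoint (th1 th2 s : R) : 0 < th1 -> 0 < th2 -> th1 + th2 = 1 ->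
  0 < s < 1 -> exists x y, [/\ 0 < x <= 1, 0 < y <= 1,
    th1 * x + th2 * y = 1 - s & th2 * entropy y <= th1 * entropy x].
Proof.
move=> t10 t20 t12 /andP[s0 s1]; have [st|ts] := ltP s th1.
  exists ((th1 - s) / th1), 1; split.
  - by rewrite divr_gt0 ?subr_gt0 //= ler_pdivrMr //; lra.
  - by rewrite ltr01 lexx.
  - by rewrite mulrC divfK ?gt_eqF // mulr1; lra.
  rewrite /entropy ln1 oppr0 mul0r mulr0 mulr_ge0 ?(ltW t10) //.
  rewrite mulr_ge0 //; first by rewrite oppr_ge0 ln_le0 // ler_pdivrMr //; lra.
  by rewrite subr_ge0 ler_pdivrMr //; lra.
(* [c] will bound [y] from below, and [B] is such that [th1 * (B / 2)] equals [th2 * - ln c];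
   [x <= expR (- B)] and [x <= 1 / 2] give [entropy x >= B / 2]. *)
set c := (1 - s) / (2 * th2).
have c0 : 0 < c by rewrite divr_gt0 ?mulr_gt0 // subr_gt0.
have c1 : c <= 1 by rewrite ler_pdivrMr ?mulr_gt0 //; lra.
have lc : 0 <= - ln c by rewrite oppr_ge0 ln_le0.
set B := th2 / th1 * - ln c * 2.
have B0 : 0 <= B by rewrite !mulr_ge0 // ?invr_ge0 ltW.
pose x := Num.min ((1 - s) / (2 * th1)) (Num.min (expR (- B)) (1 / 2)).
have x0 : 0 < x.
  by rewrite !lt_min expR_gt0 !divr_gt0 ?mulr_gt0 // subr_gt0.
have xs : th1 * x <= (1 - s) / 2.
  rewrite -ler_pdivlMl // (_ : th1^-1 * _ = (1 - s) / (2 * th1)) ?ge_min ?lexx //.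
  by field; rewrite gt_eqF.
have xB : x <= expR (- B) by rewrite !ge_min lexx /= orbT.
have xh : x <= 1 / 2 by rewrite !ge_min lexx !orbT.
have tx0 : 0 < th1 * x by rewrite mulr_gt0.
clearbody x.
exists x, ((1 - s - th1 * x) / th2).
have cy : c <= (1 - s - th1 * x) / th2.
  rewrite ler_pdivlMr // (_ : c * th2 = (1 - s) / 2); first by lra.
  by rewrite /c; field; rewrite gt_eqF.
have y1 : (1 - s - th1 * x) / th2 <= 1 by rewrite ler_pdivrMr //; lra.
set y := (1 - s - th1 * x) / th2 in cy y1 *.
have y0 : 0 < y := lt_le_trans c0 cy.
split.
- by rewrite x0 /=; lra.
- by rewrite y0.
- by rewrite /y mulrC [th2 * _]mulrC divfK ?gt_eqF //; lra.
have ey : entropy y <= - ln c.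
  rewrite /entropy; apply: (@le_trans _ _ (- ln y)).
    by rewrite ler_piMr ?oppr_ge0 ?ln_le0 //; lra.
  by rewrite lerN2 ler_ln // posrE.
have ex : B / 2 <= entropy x.
  rewrite /entropy; apply: ler_pM; rewrite ?invr_ge0 //; last by lra.
  by rewrite lerNr -[leRHS]expRK ler_ln // posrE ?expR_gt0.
apply: (@le_trans _ _ (th2 * - ln c)); first by rewrite ler_pM2l.
apply: (@le_trans _ _ (th1 * (B / 2))); last by rewrite ler_pM2l.
by rewrite /B le_eqVlt; apply/orP; left; apply/eqP; field; rewrite gt_eqF.
Qed.

Lemma continuous_entropy t : 0 < t -> {for t, continuous entropy}.
Proof.
move=> t0; apply: cvgM; first by apply: cvgN; exact: continuous_ln.
by apply: cvgB; [exact: cvg_cst|exact: cvg_id].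
Qed.

(* In terms of x = exp(-a w) and y = exp(-a b) the system says that
   th1 entropy x = th2 entropy y, and b + w = s says that th1 x + th2 y = 1 - s;
   [a] is then determined. *)
Lemma balanced_surj (th1 th2 s : R) : 0 < th1 -> 0 < th2 -> th1 + th2 = 1 ->
  0 < s < 1 -> exists a b w, [/\ 0 < a, 1 < a ^+ 2 * (th1 * th2),
    balanced a th1 th2 b w & b + w = s].
Proof.
move=> t10 t20 t12 s01.
have [x0 [y0 [/andP[x00 x01] /andP[y00 y01] e0 d0]]] := entropy_endpoint t10 t20 t12 s01.
have t21 : th2 + th1 = 1 by rewrite addrC.
have [y1 [x1 [/andP[y10 y11] /andP[x10 x11] e1 d1]]] := entropy_endpoint t20 t10 t21 s01.
(* Along the segment joining the two ends the weighted mean remains [1 - s], and [D] changes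
   sign. *)
pose X t := x0 + t * (x1 - x0); pose Y t := y0 + t * (y1 - y0).
have XY t : th1 * X t + th2 * Y t = 1 - s.
  have -> : th1 * X t + th2 * Y t = (th1 * x0 + th2 * y0)
      + t * ((th2 * y1 + th1 * x1) - (th1 * x0 + th2 * y0)) by rewrite /X /Y; ring.
  by rewrite e0 e1 subrr mulr0 addr0.
have btw (p q t : R) : 0 < p -> 0 < q -> p <= 1 -> q <= 1 -> 0 <= t <= 1 ->
    0 < p + t * (q - p) <= 1.
  move=> p0 q0 p1 q1 /andP[t0 t1]; have -> : p + t * (q - p) = (1 - t) * p + t * q by ring.
  apply/andP; split; last by nra.
  have [->|tn0] := eqVneq t 0; first by rewrite mul0r addr0 subr0 mul1r.
  have tp : 0 < t by rewrite lt_neqAle eq_sym tn0.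
  by apply: ltr_wpDl; rewrite ?mulr_gt0 // mulr_ge0 ?subr_ge0 // ltW.
pose D t := th1 * entropy (X t) - th2 * entropy (Y t).
have cD : {within `[0, 1], continuous D}.
  apply: continuous_in_subspaceT => t; rewrite inE /= in_itv /= => t01.
  have /andP[Xt _] := btw x0 x1 t x00 x10 x01 x11 t01.
  have /andP[Yt _] := btw y0 y1 t y00 y10 y01 y11 t01.
  have cl (p q : R) : (fun t => p + t * (q - p)) @ t --> p + t * (q - p).
    by apply: cvgD; [exact: cvg_cst|apply: cvgMr_tmp; exact: cvg_id].
  apply: cvgB; apply: cvgMl_tmp; apply: continuous_cvg; do ?exact: cl.
    exact: continuous_entropy.
  exact: continuous_entropy.
have D0 : 0 <= D 0 by rewrite /D /X /Y !mul0r !addr0 subr_ge0.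
have D1 : D 1 <= 0.
  by rewrite /D /X /Y !mul1r (addrC x0) (addrC y0) !subrK subr_le0.
have [|t t01 Dt] := IVT (v := 0) (@ler01 R) cD.
  by rewrite ge_min le_max D0 D1 orbT.
rewrite in_itv /= in t01.
have /andP[X0 X1] := btw x0 x1 t x00 x10 x01 x11 t01.
have /andP[Y0 Y1] := btw y0 y1 t y00 y10 y01 y11 t01.
have := XY t; move: Dt; rewrite /D -/(X t) -/(Y t) in X0 X1 Y0 Y1 *.
move: (X t) (Y t) X0 X1 Y0 Y1 => {X Y XY D cD D0 D1 x0 x1 y0 y1}
  {x00 x01 x10 x11 y00 y01 y10 y11 e0 e1 d0 d1} x y x0 x1 y0 y1.
move=> /eqP; rewrite subr_eq0 => /eqP Exy xy; case/andP: s01 => s0 s1.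
have lpos (z : R) : 0 < z -> z < 1 -> 0 < - ln z by move=> z0 z1; rewrite oppr_gt0 ln_lt0 // z0.
have x1' : x < 1.
  rewrite lt_neqAle x1 andbT; apply/eqP => ex.
  move: Exy; rewrite /entropy ex subrr !mulr0 => /esym/eqP.
  have yl : y < 1 by move: xy; rewrite ex -(ltr_pM2l t20) mulr1; lra.
  by rewrite mulf_eq0 gt_eqF //= gt_eqF // mulr_gt0 ?lpos // subr_gt0.
have y1' : y < 1.
  rewrite lt_neqAle y1 andbT; apply/eqP => ey.
  move: Exy; rewrite /entropy ey subrr !mulr0 => /eqP.
  by rewrite mulf_eq0 gt_eqF //= gt_eqF // mulr_gt0 ?lpos // subr_gt0.
have lx := lpos _ x0 x1'; have ly := lpos _ y0 y1'.
have x1s : 0 < 1 - x by rewrite subr_gt0.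
have y1s : 0 < 1 - y by rewrite subr_gt0.
have b0 : 0 < th1 * (1 - x) by rewrite mulr_gt0.
have w0 : 0 < th2 * (1 - y) by rewrite mulr_gt0.
pose a := - ln x / (th2 * (1 - y)).
have aE : a = - ln y / (th1 * (1 - x)).
  have b0' := lt0r_neq0 b0; have w0' := lt0r_neq0 w0.
  apply/eqP; rewrite /a eqr_div //; apply/eqP.
  by rewrite [LHS]mulrCA [RHS]mulrCA; exact: Exy.
have a0 : 0 < a by rewrite divr_gt0.
have hl (z : R) : 0 < z -> z < 1 -> 1 - z < - ln z.
  move=> z0 z1; have : 1 + ln z < expR (ln z).
    by apply: expR_gt1Dx; rewrite -oppr_eq0 gt_eqF // lpos.
  by rewrite lnK ?posrE //; lra.
exists a, (th1 * (1 - x)), (th2 * (1 - y)); split => //.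
(* Each factor exceeds 1, since [1 - z < - ln z] for [0 < z < 1]. *)
- have -> : a ^+ 2 * (th1 * th2) = (- ln x / (1 - x)) * (- ln y / (1 - y)).
    rewrite expr2 {1}/a aE; field.
    by do ?[apply/andP; split]; rewrite gt_eqF.
  rewrite -[ltLHS]mulr1; apply: ltr_pM => //; by rewrite ltr_pdivlMr // mul1r hl.
- split => //.
  + by rewrite /a divfK ?gt_eqF // /hitp opprK lnK // posrE.
  + by rewrite aE divfK ?gt_eqF // /hitp opprK lnK // posrE.
- by move: xy; lra.
Qed.

(** * From the two masses to total mass and proportion *)

Lemma alpha_gt0 theta : 0 < theta < 1 -> 0 < alpha theta.
Proof.
by case/andP=> t0 t1; rewrite /alpha powR_gt0 // mulr_gt0 // subr_gt0.
Qed.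

Lemma alpha_sqr theta : 0 < theta < 1 ->
  alpha theta ^+ 2 * (theta * (1 - theta)) = 1.
Proof.
case/andP=> t0 t1; have p0 : 0 < theta * (1 - theta) by rewrite mulr_gt0 // subr_gt0.
rewrite /alpha powRN powR12_sqrt ?ltW // exprVn sqr_sqrtr ?ltW //.
by rewrite mulVf // gt_eqF.
Qed.

Lemma is_solutionE theta lambda (l r : R) : is_solution theta lambda (l, r) <->
  balanced (alpha theta * lambda) theta (1 - theta) (r * l) ((1 - r) * l) /\
  0 < l < 1.
Proof.
rewrite /is_solution /balanced /hitp !mulrA; split.
  move=> [/andP[l0 l1] /andP[r0 r1] e1 e2]; split; last by rewrite l0.
  by split => //; rewrite mulr_gt0 // subr_gt0.
move=> [[b0 w0 e1 e2] /andP[l0 l1]]; split => //; first by rewrite l0.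
by move: b0 w0; rewrite !pmulr_lgt0 // => -> /=; rewrite subr_gt0.
Qed.

Lemma balanced_solution theta lambda b w : 0 < theta < 1 ->
  balanced (alpha theta * lambda) theta (1 - theta) b w ->
  is_solution theta lambda (b + w, b / (b + w)).
Proof.
move=> /andP[t0 t1] s; have [b0 w0 eb ew] := s.
have l0 : 0 < b + w by rewrite addr_gt0.
apply/is_solutionE; rewrite divfK ?gt_eqF //.
rewrite (_ : (1 - _) * _ = w); last by field; rewrite gt_eqF.
split => //; rewrite l0 eb ew /=.
have h1 := hitp_lt1 (alpha theta * lambda * w).
have h2 := hitp_lt1 (alpha theta * lambda * b).
have : theta * hitp (alpha theta * lambda * w) < theta * 1 by rewrite ltr_pM2l.
have : (1 - theta) * hitp (alpha theta * lambda * b) < (1 - theta) * 1.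
  by rewrite ltr_pM2l // subr_gt0.
rewrite -eb -ew; lra.
Qed.

End Analysis.

(** * The law of the table *)

(** Such a set is the union of the atoms of finitely many events that it contains. *)
Lemma measurable_finite_bits d (T : measurableType d) (I : finType)
    (bits : I -> T -> bool) (A : set T) :
  (forall i, measurable [set x | bits i x]) ->
  (forall x y, (forall i, bits i x = bits i y) -> A x -> A y) -> measurable A.
Proof.
move=> mb hA; pose F (t : {ffun I -> bool}) := \bigcap_i [set x | bits i x = t i].
have mF t : measurable (F t).
  apply: fin_bigcap_measurable => // i _; case: (t i); first exact: mb.
  rewrite (_ : [set _ | _] = ~` [set x | bits i x]); first exact: measurableC.
  by apply/seteqP; split => x /=; case: (bits i x).
rewrite (_ : A = \bigcup_(t in [set t | F t `<=` A]) F t).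
  by apply: fin_bigcup_measurable => // t _; exact: mF.
apply/seteqP; split => [x Ax|x [t /= h Ftx]]; last exact: h.
exists [ffun i => bits i x]; last by move=> i _ /=; rewrite ffunE.
by move=> y Fy; apply: hA Ax => i; have := Fy i Logic.I; rewrite /= ffunE.
Qed.

(** * Independence of one variable from the others *)

Section Independence.
Context d (T : measurableType d) (R : realType) (P : probability T R).
Context (I : finType) (X : I -> {RV P >-> R}).
Hypothesis X_indep : mutually_independent X.

Definition sigma_gen (D : pred I) : set (set T) :=
  \bigcup_(i in [set i | D i]) preimage_set_system setT (X i) measurable.

Lemma sigma_gen_measurable D : sigma_gen D `<=` measurable.
Proof.
by move=> A [i _ [B mB <-]]; exact: measurable_funP.
Qed.

(** Both sides are finite measures in [C]. They agree on the intersection-stable class [H] of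
    product events, which contains the generators of the sigma-algebra. *)
Lemma independent_sigma_gen (D : pred I) (f : I) (B : set R) (C : set T) :
  ~~ D f -> measurable B -> <<s sigma_gen D >> C ->
  P (C `&` X f @^-1` B) = (P (X f @^-1` B) * P C)%E.
Proof.
move=> nDf mB sC.
have mXB i (B' : set R) : measurable B' -> measurable (X i @^-1` B').
  by move=> mB'; rewrite -[X in measurable X]setTI; exact: measurable_funP.
have mA : measurable (X f @^-1` B) by exact: mXB.
pose H : set (set T) := [set A | exists2 Bs : I -> set R,
  (forall i, measurable (Bs i)) /\ (forall i, ~~ D i -> Bs i = setT) &
  A = \bigcap_(i in [set` [set: I]%SET]) (X i @^-1` Bs i)].
have HI : setI_closed H.
  move=> _ _ [B1 [m1 t1] ->] [B2 [m2 t2] ->].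
  exists (fun i => B1 i `&` B2 i).
    by split=> [i|i Di]; [exact: measurableI|rewrite t1 // t2 // setIT].
  rewrite -bigcapI; apply: eq_bigcapr => i _; exact/esym/preimage_setI.
have Hm : H `<=` measurable.
  by move=> _ [Bs [mBs _] ->]; apply: fin_bigcap_measurable => // i _; exact: mXB.
have sub : sigma_gen D `<=` H.
  move=> _ [i /= Di [B' mB' <-]]; exists (fun j => if j == i then B' else setT).
    split=> [j|j Dj]; first by case: ifP.
    by case: eqP => // ji; rewrite ji Di in Dj.
  rewrite setTI; apply/seteqP; split => [x Bx j _|x /(_ i)] /=.
    by case: eqP => // ->.
  by rewrite eqxx; apply; rewrite /= finset.in_setT.
have fin_P A : measurable A -> P A \is a fin_num by exact: fin_num_measure.
have rge : 0 <= fine (P (X f @^-1` B)) by rewrite fine_ge0.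
pose m1 := mrestr P mA; pose m2 := mscale (NngNum rge) P.
rewrite -(fineK (fin_P _ mA)).
apply: (@g_sigma_algebra_measure_unique _ _ _ H Hm (fun=> setT) _ _ m1 m2 HI).
- by move=> _; exists (fun=> setT) => //; apply/seteqP; split => x _ // i _.
- by apply/seteqP; split => // x _; exists 0%N.
- move=> A [Bs [mBs tBs] eA].
  change (P (A `&` X f @^-1` B) = ((fine (P (X f @^-1` B)))%:E * P A)%E).
  rewrite fineK ?fin_P //.
  pose Bs' i := if i == f then B else Bs i.
  have -> : A `&` X f @^-1` B = \bigcap_(i in [set` [set: I]%SET]) (X i @^-1` Bs' i).
    rewrite eA; apply/seteqP; split => [x [Ax Bx] j jI|x Ax] /=.
      by rewrite /Bs'; case: eqP => [->//|_]; exact: Ax.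
    split=> [j jI|]; last first.
      by have := Ax f; rewrite /Bs' /= eqxx; apply; rewrite finset.in_setT.
    have := Ax j jI; rewrite /Bs' /=; case: eqP => [-> _|//].
    by rewrite tBs.
  rewrite eA !X_indep //; last by move=> i; rewrite /Bs'; case: ifP.
  rewrite [LHS](bigD1 f) ?finset.in_setT //= [in RHS](bigD1 f) ?finset.in_setT //=.
  rewrite {1}/Bs' eqxx [Bs f]tBs // preimage_setT probability_setT mul1e.
  by congr (_ * _)%E; apply: eq_bigr => i /andP[_ /negbTE ne]; rewrite /Bs' ne.
- by move=> _; rewrite /m1 /mrestr /= ltey_eq fin_P // setTI.
- by apply: sub_smallest2r sC => //; exact: sub.
Qed.

End Independence.

Lemma uniform01_le (R : realType) (p : R) : 0 <= p <= 1 ->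
  uniform_prob (@ltr01 R) `]-oo, p]%classic = p%:E.
Proof.
move=> /andP[p0 p1]; rewrite /uniform_prob integral_uniform_pdf.
have -> : `]-oo, p]%classic `&` `[0, 1]%classic = `[0, p]%classic :> set R.
  apply/seteqP; split => x /=; rewrite !in_itv /=; lra.
rewrite (eq_integral (fun=> 1%E)); last first.
  move=> x; rewrite inE /= in_itv /= /uniform_pdf => /andP[x0 xp].
  by rewrite x0 (le_trans xp p1) subr0 invr1.
rewrite integral_cst //= mul1e lebesgue_measure_itv /= lte_fin.
by case: ltP => [_|pn]; rewrite ?sube0 //; congr (_%:E); lra.
Qed.

Section TableLaw.
Context d (T : measurableType d) (R : realType) (P : probability T R).
Context (b w : nat) (U : edge b w -> {RV P >-> R}).
Hypothesis U_iid : iid_uniform01 U.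
Local Notation E := (edge b w).

Lemma sigma_gen_tab (D : pred E) (p : R) (A : set T) :
  (forall x y, (forall e f, D e -> D f -> (U e x <= U f x) = (U e y <= U f y)) ->
     (forall e, D e -> (U e x <= p) = (U e y <= p)) -> A x -> A y) ->
  <<s sigma_gen U D >> A.
Proof.
(* [T'] is [T] with the coarser sigma-algebra, so measurability in [T'] is membership in it. *)
move=> hA; pose T' := g_sigma_algebraType (sigma_gen U D).
have mU e : D e -> measurable_fun [set: T'] (U e : T' -> R).
  move=> De _ B mB; apply: sub_gen_smallest; exists e => //.
  by exists B.
pose bits (i : E * E + E) (x : T') : bool := match i with
  | inl ef => [&& D ef.1, D ef.2 & U ef.1 x <= U ef.2 x]
  | inr e => D e && (U e x <= p) end.
suff : measurable (A : set T') by [].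
apply: (@measurable_finite_bits _ T' _ bits).
  have mbool (g : T' -> bool) : measurable_fun setT g -> measurable [set x | g x].
    move=> mg; have := mg measurableT [set true]; rewrite setTI; apply.
    by [].

  case=> [[e f]|e]; rewrite /bits /=.
    case De : (D e) => /=; last by rewrite (_ : [set _ | _] = set0) // -subset0 => x.
    case Df : (D f) => /=; last by rewrite (_ : [set _ | _] = set0) // -subset0 => x.
    by apply: mbool; apply: measurable_realfun.measurable_fun_ler; exact: mU.
  case De : (D e) => /=; last by rewrite (_ : [set _ | _] = set0) // -subset0 => x.
  by apply: mbool; apply: measurable_realfun.measurable_fun_ler; [exact: mU|exact: measurable_cst].
move=> x y h; apply: hA => [e f De Df|e De].
  by have := h (inl (e, f)); rewrite /bits /= De Df.
by have := h (inr e); rewrite /bits /= De.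
Qed.

Lemma sigma_gen_sigma_of D A : <<s sigma_gen U D >> A -> sigma_of U A.
Proof.
apply: smallest_sub; first exact: smallest_sigma_algebra.
by move=> B [e _ hB]; apply: sub_gen_smallest; exists e.
Qed.

Lemma sigma_gen_meas D A : <<s sigma_gen U D >> A -> measurable A.
Proof.
apply: smallest_sub; first exact: sigma_algebra_measurable.
exact: sigma_gen_measurable.
Qed.

Section Fixp.
Variable p : R.
Hypothesis p01 : 0 <= p <= 1.

Definition rtab (x : T) : table b w := tab (fun e => U e x) p.

Definition mu (t : table b w) : R := fine (P (rtab @^-1` [set t])).

Lemma rtab_sigma (D : pred E) (A : set (table b w)) :
  (forall t t' : table b w, (forall e f, D e -> D f -> t.1 (e, f) = t'.1 (e, f)) ->
     (forall e, D e -> t.2 e = t'.2 e) -> A t -> A t') ->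
  <<s sigma_gen U D >> (rtab @^-1` A).
Proof.
move=> hA; apply: (@sigma_gen_tab D p) => x y h1 h2; apply: hA => [e f De Df|e De].
  by rewrite !ffunE /= h1.
by rewrite !ffunE h2.
Qed.

Lemma rtab_sigmaT (A : set (table b w)) : <<s sigma_gen U predT >> (rtab @^-1` A).
Proof.
apply: rtab_sigma => -[t1 t2] [t1' t2'] /= h1 h2.
suff -> : t1 = t1' by suff -> : t2 = t2' by []; apply/ffunP => e; rewrite h2.
by apply/ffunP => -[e f]; rewrite h1.
Qed.

Lemma rtab_meas (A : set (table b w)) : measurable (rtab @^-1` A).
Proof. exact: sigma_gen_meas (rtab_sigmaT A). Qed.

Lemma mu_ge0 t : 0 <= mu t.
Proof. exact: fine_ge0. Qed.

Lemma mu_sumE (A : pred (table b w)) :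
  P (rtab @^-1` [set t | A t]) = (\sum_(t | A t) mu t)%:E.
Proof.
have seqE (s : seq (table b w)) : uniq s ->
    P (rtab @^-1` [set t | t \in s]) = (\sum_(t <- s) mu t)%:E.
  elim: s => [_|t s ih /= /andP[ts us]].
    rewrite big_nil (_ : _ @^-1` _ = set0) ?measure0 // -subset0 => x /=.
    by rewrite in_nil.
  rewrite big_cons EFinD -ih // /mu fineK ?fin_num_measure //; last exact: rtab_meas.
  rewrite -measureU; [|exact: rtab_meas|exact: rtab_meas|].
    congr (P _); apply/seteqP; split => x /=; rewrite inE.
      by move=> /orP[/eqP|]; [left|right].
    by move=> [->|->]; rewrite ?eqxx ?orbT.
  rewrite -subset0 => x [/= -> ]; exact/negP.
rewrite -big_filter -seqE; last by rewrite filter_uniq // index_enum_uniq.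
congr (P _); apply/seteqP; split => x /=; rewrite mem_filter mem_index_enum andbT //.
Qed.

Lemma mu_sum : \sum_t mu t = 1.
Proof.
apply: EFin_inj; rewrite -mu_sumE (_ : _ @^-1` _ = setT) ?probability_setT //.
by apply/seteqP; split.
Qed.

(** A canonical representative of [t] under [agree_off e]; its fibres are the atoms of the
    information on the other edges. *)
Definition erase (e : E) (t : table b w) : table b w :=
  ([ffun ff => [&& ff.1 != e, ff.2 != e & t.1 ff]], [ffun f => (f != e) && t.2 f]).

Lemma erase_agree e t : agree_off e t (erase e t).
Proof.
by split=> [f f' h1 h2|f h]; rewrite ffunE /= ?h1 ?h2 ?h.
Qed.

(** Whether the erased table is [s] depends on the other weights only, hence is independent of [e]
    being open. *)
Lemma open_indep e s :
  \sum_(t | (erase e t == s) && t.2 e) mu t = p * \sum_(t | erase e t == s) mu t.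
Proof.
apply: EFin_inj; rewrite EFinM -!mu_sumE.
have -> : rtab @^-1` [set t | (erase e t == s) && t.2 e] =
    rtab @^-1` [set t | erase e t == s] `&` U e @^-1` `]-oo, p].
  apply/seteqP; split => x /=; rewrite in_itv /= ffunE.
    by move=> /andP[].
  by move=> [-> ->].
have mI : measurable (`]-oo, p]%classic : set R) by exact: measurable_itv.
rewrite (independent_sigma_gen U_iid.1 (D := fun f => f != e)) ?eqxx //.
  by rewrite U_iid.2 // uniform01_le.
apply: rtab_sigma => t t' h1 h2 /= /eqP <-; apply/eqP; congr pair.
  apply/ffunP => -[f f']; rewrite !ffunE /=.
  by case fe: (f == e) => //=; case fe': (f' == e) => //=; rewrite h1 ?fe ?fe'.
by apply/ffunP => f; rewrite !ffunE; case fe: (f == e) => //=; rewrite h2 ?fe.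
Qed.

Lemma mu_indep (Q : R) e (F : table b w -> R) : 1 - Q^-1 = p ->
  (forall t t', agree_off e t t' -> F t = F t') ->
  \sum_t mu t * (noise Q t e * F t) = 0.
Proof.
move=> Qp hF; rewrite (partition_big (erase e) predT) //= big1 // => s _.
have -> : \sum_(t | erase e t == s) mu t * (noise Q t e * F t) =
    F s * (\sum_(t | (erase e t == s) && t.2 e) mu t - p * \sum_(t | erase e t == s) mu t).
  rewrite [X in _ * (X - _)]big_mkcondr /= mulr_sumr -sumrB mulr_sumr.
  apply: eq_bigr => t /eqP ts.
  rewrite (hF _ _ (erase_agree e t)) ts /noise Qp.
  by case: (t.2 e) => /=; ring.
by rewrite open_indep subrr mulr0.
Qed.

End Fixp.
End TableLaw.

(** * Convergence of the proportion of black vertices *)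

Lemma black_class b w : black b w = class b w true.
Proof. by apply/setP => v; rewrite !inE eqb_id. Qed.

Lemma card_class b w c : #|class b w c| = if c then b else w.
Proof.
case: c.
  have -> : class b w true = [set inl i | i : 'I_b]%SET.
    apply/setP => -[i|j]; rewrite !inE; apply/esym; first exact: imset_f.
    by apply/imsetP => -[].
  by rewrite card_imset ?card_ord // => i j [].
have -> : class b w false = [set inr i | i : 'I_w]%SET.
  apply/setP => -[i|j]; rewrite !inE; apply/esym; last exact: imset_f.
  by apply/imsetP => -[].
by rewrite card_imset ?card_ord // => i j [].
Qed.

Lemma card_classI b w (S : {set vertex b w}) c :
  (#|S :&: class b w c| + #|S :&: class b w (~~ c)|)%N%SET = #|S|.
Proof.
rewrite -(cardsID (class b w c) S); congr (_ + _)%N.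
by apply: eq_card => v; rewrite finset.in_setI finset.in_setD class_neq andbC.
Qed.

(** * Approximate balance at the end of the run *)

Section Balance.
Context (R : realType) (b w : nat) (u : edge b w -> R) (v0 : vertex b w).
Context (m : nat) (a h : R) (c : bool).
Hypotheses (b_gt0 : (0 < b)%N) (w_gt0 : (0 < w)%N) (m_gt0 : (0 < m)%N).
Hypotheses (m_le : (m <= b + w)%N) (a_gt0 : 0 < a).

Let N : R := (b + w)%:R.
Let Q := expR (a / N).
Let t := tab u (1 - Q^-1).
Let S := trun m t v0 (b + w).
Let cnt c : R := #|(S :&: class b w c)%SET|%:R.

(** No open edge leaves [S], so no unvisited vertex of colour [c] is hit and the potential is the
    number of these vertices times the weight [expR (a * (cnt (~~ c) / N))]. The claim is
    [pot_bounds] divided by this weight. *)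
Lemma run_balance : `|mart Q c m t v0 (b + w)| <= h ->
  #|class b w c|%:R * hitp (a * (cnt (~~ c) / N)) - h <= cnt c
    <= #|class b w c|%:R * hitp (a * (cnt (~~ c) / N)) + (expR a * m%:R + h).
Proof.
have N0 : 0 < N by rewrite ltr0n; lia.
have Q1 : 1 <= Q by rewrite -expR0 ler_expR divr_ge0 // ltW.
have QN : Q ^+ (b + w) <= expR a.
  by rewrite /Q -expRM_natr divfK // gt_eqF.
move=> hM; have := pot_bounds c t v0 (b + w) m_gt0 Q1 QN; rewrite -/S.
have [_ closed] := trun_closed u (1 - Q^-1) v0 m_gt0 m_le b_gt0 w_gt0.
have -> : pot Q c t S = (#|class b w c|%:R - cnt c) * weight Q c S.
  rewrite /pot (eq_bigl (mem (class b w c :\: S)%SET)); last first.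
    move=> x; rewrite -[RHS]/(x \in _) finset.in_setD [RHS]andbC.
    case xc: (x \in class b w c) => //=; case xS: (x \in S) => //=.
    apply/negP => /hitP[e [ex eS te]]; have := closed e; rewrite -/t -/S te => /(_ _)/negP.
    by apply => //; rewrite (crossingE c) ex xS eS.
  rewrite sumr_const -[LHS]mulr_natl cardsD natrB; last exact: subset_leq_card (finset.subsetIl _ _).
  by rewrite finset.setIC.
have wE : weight Q c S * expR (- (a * (cnt (~~ c) / N))) = 1.
  rewrite /weight /Q -expRM_natr -expRD (_ : _ + _ = 0) ?expR0 //.
  by rewrite /cnt; ring.
set W := weight Q c S in wE *; rewrite /hitp; set y := expR _ in wE *.
have y0 : 0 < y by rewrite expR_gt0.
have W1 : 1 <= W by rewrite /W /weight exprn_ege1.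
have y1 : y <= 1.
  by rewrite -wE ler_peMl // ltW.
have m1 : (minn #|S| m)%:R <= m%:R :> R by rewrite ler_nat geq_minr.
have {}m1 : expR a * (minn #|S| m)%:R <= expR a * m%:R by rewrite ler_wpM2l // expR_ge0.
have e0 : 0 <= expR a * m%:R by rewrite mulr_ge0 // expR_ge0.
move: hM; rewrite ler_norml; set M := mart _ _ _ _ _ _; set n := _%:R.
move: m1 e0; set z1 := expR a * _; set z2 := expR a * _ => m1 e0.
move=> /andP[M1 M2] /andP[H1 H2].
have h0 : 0 <= h by lra.
have G1 : (n - cnt c) * W * y <= (n + h) * y by rewrite ler_pM2r //; lra.
have G2 : (n - z2 - h) * y <= (n - cnt c) * W * y by rewrite ler_pM2r //; lra.
have G3 : h * y <= h by rewrite ler_piMr.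
have G4 : (z2 + h) * y <= z2 + h by rewrite ler_piMr // addr_ge0.
move: G1 G2; rewrite -mulrA wE mulr1; lra.
Qed.

End Balance.

(** The errors in [Bk - k * (b0 / s)] add up to at most [2 + 3 * kappa * N = 2 + eps * s * N / 4],
    which is at most [eps * s * N / 2], hence at most [eps * k]. *)
Lemma ratio_close (R : realType) (N s b0 kappa eps bS KS Bk k : R) :
  0 < N -> 0 < s -> 0 < b0 -> b0 < s -> 0 < eps ->
  `|bS / N - b0| <= kappa -> `|KS / N - s| <= 2 * kappa ->
  `|Bk - bS| <= `|k - KS| -> k <= s * N -> s * N < k + 1 ->
  kappa = eps * s / 12 -> 8 <= eps * s * N -> 2 <= s * N ->
  `|Bk / k - b0 / s| <= eps.
Proof.
move=> N0 s0 b00 b0s e0 hb hK hB k1 k2 kE n1 n2.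
have {}hb : `|bS - b0 * N| <= kappa * N.
  rewrite -ler_pdivrMr // -[X in _ / X](gtr0_norm N0) -normf_div.
  by rewrite mulrBl mulfK // gt_eqF.
have {}hK : `|KS - s * N| <= 2 * kappa * N.
  rewrite -ler_pdivrMr // -[X in _ / X](gtr0_norm N0) -normf_div.
  by rewrite mulrBl mulfK // gt_eqF.
have kp : 0 < k by lra.
set q := b0 / s; have q0 : 0 < q by rewrite divr_gt0.
have q1 : q <= 1 by rewrite ler_pdivrMr // mul1r ltW.
have qE : b0 = q * s by rewrite /q divfK // gt_eqF.
have hq : 0 <= q * (s * N - k) <= 1.
  apply/andP; split; first by rewrite mulr_ge0 ?subr_ge0 // ltW.
  by rewrite mulr_ile1 // ?subr_ge0 // 1?ltW //; lra.
have -> : Bk / k - q = (Bk - k * q) / k.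
  by rewrite mulrBl [k * q]mulrC mulfK // gt_eqF.
rewrite normf_div (gtr0_norm kp) ler_pdivrMr //.
have hk : `|k - KS| <= 1 + 2 * kappa * N.
  by move: hK; rewrite !ler_norml => /andP[]; lra.
have {}hB := le_trans hB hk.
have -> : Bk - k * q = (Bk - bS) + (bS - b0 * N) + q * (s * N - k) by rewrite qE; ring.
have ek : eps * (s * N / 2) <= eps * k by rewrite ler_pM2l //; lra.
have kN : kappa * N = eps * s * N / 12 by rewrite kE; ring.
have : `|Bk - bS + (bS - b0 * N) + q * (s * N - k)| <= (1 + 2 * kappa * N) + kappa * N + 1.
  apply: le_trans (ler_normD _ _) _; apply: lerD.
    by apply: le_trans (ler_normD _ _) _; exact: lerD.
  by case/andP: hq => hq0 hq1; rewrite ger0_norm.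
move: ek n1 kN; rewrite !mulrA; lra.
Qed.

Lemma scaled_bounds (R : realType) (N n g z eta C e m : R) : 0 < N -> 0 < C ->
  m <= 2 * e * N -> n * g - eta * N <= z <= n * g + (C * m + eta * N) ->
  n / N * g - eta <= z / N <= n / N * g + (2 * C * e + eta).
Proof.
move=> N0 C0 hm /andP[z1 z2]; have Nn : N != 0 by rewrite gt_eqF.
have E2 : C * m <= 2 * C * e * N.
  by rewrite (_ : 2 * C * e * N = C * (2 * e * N)) ?ler_pM2l //; ring.
apply/andP; split.
  by rewrite ler_pdivlMr // (_ : _ * N = n * g - eta * N) //; field.
rewrite ler_pdivrMr // (_ : _ * N = n * g + (2 * C * e * N + eta * N)); last by field.
by apply: (le_trans z2); rewrite lerD2l lerD2r.
Qed.

(** The deterministic half of the convergence: only the size of the two martingales is left to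
    probability. *)
Lemma ratio_of_balance (R : realType) (th a b0 w0 eps : R) :
  0 < th < 1 -> 0 < a -> balanced a th (1 - th) b0 w0 -> 0 < eps ->
  exists eta e N0, [/\ 0 < eta, 0 < e & forall (b w : nat) (u : edge b w -> R) v0,
    let N : R := (b + w)%:R in let Q := expR (a / N) in
    let m := (Num.truncn (e * N)).+1 in
    N0 <= N -> `|b%:R / N - th| <= eta ->
    [/\ (0 < m)%N, (0 < b)%N, (0 < w)%N & 
     ((forall c, `|mart Q c m (tab u (1 - Q^-1)) v0 (b + w)| <= eta * N) ->
     `|black_ratio u v0 (Num.truncn ((b0 + w0) * N)) - b0 / (b0 + w0)| <= eps)]].
Proof.
move=> /andP[th0 th1] a0 bal eps0; have [b00 w00 eb ew] := bal.
have th'0 : 0 < 1 - th by rewrite subr_gt0.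
set s := b0 + w0; have s0 : 0 < s by rewrite addr_gt0.
set kappa := eps * s / 12; have k0 : 0 < kappa by rewrite !mulr_gt0 ?invr_gt0.
have K0 : 0 < 2 * expR a by rewrite mulr_gt0 // expR_gt0.
have [e1 e10 st] := balanced_stable a0 th0 th'0 K0 k0 bal.
pose e := Num.min e1 (1 / 4).
have ep : 0 < e by rewrite lt_min e10 divr_gt0.
have e4 : e <= 1 / 4 by rewrite ge_min lexx orbT.
have [|eta1 eta10 {}st] := st e ep; first by rewrite ge_min lexx.
(* Half of [eta1] pays for the fluctuation, half for replacing [b / N] by [th]; the other two bounds
   keep both colours present. *)
pose eta := Num.min (eta1 / 2) (Num.min (th / 2) ((1 - th) / 2)).
have eta0 : 0 < eta by rewrite !lt_min; apply/and3P; split; apply: divr_gt0.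
have [et1 et2 et3] : [/\ eta <= eta1 / 2, eta <= th / 2 & eta <= (1 - th) / 2].
  by rewrite /eta !ge_min !lexx /= !orbT.
(* The four terms provide, in turn, [1 <= e * N], [2 <= N], [8 <= eps * s * N] and [2 <= s * N]. *)
exists eta, e, (e^-1 + 2 + 8 / (eps * s) + 2 / s); split => //.
clearbody eta e; move=> b w u v0 N Q m hN hb.
have es0 : 0 < eps * s by rewrite mulr_gt0.
have p1 : 0 < e^-1 by rewrite invr_gt0.
have p2 : 0 < 8 / (eps * s) by rewrite divr_gt0.
have p3 : 0 < 2 / s by rewrite divr_gt0.
have N0 : 0 < N by apply: lt_le_trans hN; lra.
have n1 : 1 <= e * N by rewrite mulrC -ler_pdivrMr // div1r; apply: le_trans hN; lra.
have n2 : 8 <= eps * s * N by rewrite mulrC -ler_pdivrMr //; apply: le_trans hN; lra.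
have n3 : 2 <= s * N by rewrite mulrC -ler_pdivrMr //; apply: le_trans hN; lra.
have n4 : 2 <= N by apply: le_trans hN; lra.
have NE : N = b%:R + w%:R by rewrite /N natrD.
have wE : w%:R / N = 1 - b%:R / N.
  rewrite -[X in X - _](@divff _ N) ?gt_eqF // -mulrBl; congr (_ / _).
  by rewrite NE [RHS]addrAC subrr add0r.
move: hb; rewrite ler_norml => /andP[hb1 hb2].
have bN : 0 < b%:R / N by lra.
have wN : 0 < w%:R / N by lra.
have b_gt0 : (0 < b)%N by move: bN; rewrite pmulr_lgt0 ?invr_gt0 // ltr0n.
have w_gt0 : (0 < w)%N by move: wN; rewrite pmulr_lgt0 ?invr_gt0 // ltr0n.
split => // hM.
have eN0 : 0 <= e * N by lra.
have /andP[tr1 tr2] := Num.Theory.truncn_itv eN0.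
have mle : m%:R <= 2 * e * N :> R by rewrite /m -natr1; lra.
have mge : e * N <= m%:R by exact: ltW.
have m_le : (m <= b + w)%N.
  rewrite -(ler_nat R) -/N /m -natr1.
  have : e * N <= 1 / 4 * N by rewrite ler_pM2r.
  by lra.
have m_gt0 : (0 < m)%N by [].
pose t := tab u (1 - Q^-1); pose S := trun m t v0 (b + w).
have [mS _] := trun_closed u (1 - Q^-1) v0 m_gt0 m_le b_gt0 w_gt0.
have B1 := run_balance b_gt0 w_gt0 m_gt0 m_le a0 (hM true).
have B2 := run_balance b_gt0 w_gt0 m_gt0 m_le a0 (hM false).
move: B1 B2; rewrite !card_class /= -/N -/Q -/t -/S.
rewrite -/t -/S in mS.
set x : R := #|(S :&: class b w true)%SET|%:R; set y : R := #|(S :&: class b w false)%SET|%:R.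
have SE : #|S|%:R = x + y by rewrite -(card_classI S true) natrD.
have x0 : 0 <= x by rewrite /x.
have y0 : 0 <= y by rewrite /y.
move=> B1 B2.
have {}B1 := scaled_bounds N0 (expR_gt0 a) mle B1.
have {}B2 := scaled_bounds N0 (expR_gt0 a) mle B2.
have hb1' r : 0 <= r -> `|(b%:R / N - th) * hitp (a * r)| <= eta.
  move=> r0; rewrite normrM -[leRHS]mulr1 ler_pM ?normr_ge0 //.
    by rewrite ler_norml; apply/andP; split; lra.
  by rewrite ger0_norm ?hitp_ge0 ?mulr_ge0 // ltW ?hitp_lt1.
have yN0 : 0 <= y / N by rewrite divr_ge0 // ltW.
have xN0 : 0 <= x / N by rewrite divr_ge0 // ltW.
have Y := hb1' _ yN0; have X := hb1' _ xN0.
have [hx hy] : `|x / N - b0| <= kappa /\ `|y / N - w0| <= kappa.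
  apply: st => //.
  - rewrite -mulrDl -SE ler_pdivlMr //; apply: le_trans mge _.
    by rewrite ler_nat.
  - move: Y; rewrite mulrBl ler_norml => /andP[]; move: B1 => /andP[]; lra.
  - move: X; rewrite mulrBl ler_norml => /andP[]; move: B2 => /andP[].
    rewrite wE !mulrBl !mul1r; lra.
have sN0 : 0 <= s * N by lra.
have /andP[k1 k2] := Num.Theory.truncn_itv sN0.
rewrite /black_ratio black_class.
apply: (@ratio_close _ N s b0 kappa eps x (x + y) _ _) => //.
- by rewrite /s ltrDl.
- rewrite mulrDl (_ : _ - s = (x / N - b0) + (y / N - w0)); last by rewrite /s; ring.
  by apply: le_trans (ler_normD _ _) _; rewrite mulr_natl mulr2n lerD.
(* [S] is the set of Prim's algorithm at time [#|S|], so the Lipschitz bound compares it with time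
   [k]. *)
- set k := Num.truncn _; have xE : x = #|(prim_set u v0 #|S| :&: class b w true)%SET|%:R.
    by rewrite /x {1}/S (trun_prim _ _ _ _ m_gt0).
  rewrite -SE xE.
  have [kS|Sk] := leqP k #|S|.
    have := card_prim_set_lip u v0 (class b w true) kS.
    rewrite -!(ler_nat R) natrD natrB // => /andP[c1 c2].
    rewrite distrC [leRHS]distrC ger0_norm ?subr_ge0 // ger0_norm ?subr_ge0 ?ler_nat //; lra.
  have := card_prim_set_lip u v0 (class b w true) (ltnW Sk).
  rewrite -!(ler_nat R) natrD natrB ?(ltnW Sk) // => /andP[c1 c2].
  rewrite ger0_norm ?subr_ge0 // ger0_norm ?subr_ge0 ?ler_nat ?(ltnW Sk) //; lra.
- by rewrite natr1.
Qed.

(** * Tail bounds for random weights and a random start *)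

Section Tail.
Context d (T : measurableType d) (R : realType) (P : probability T R).

(** By independence, [Y = v] and [A v] occur together with probability at most [delta / #|F|]; sum
    over [v]. *)
Lemma uniform_mixture (F : finType) (Y : T -> F) (I : Type) (X : I -> {RV P >-> R})
    (A : F -> set T) (delta : R) : 0 <= delta ->
  uniform_element P Y -> independent_of Y X ->
  (forall v, sigma_of X (A v)) -> (forall v, (P (A v) <= delta%:E)%E) ->
  (P [set x | A (Y x) x] <= delta%:E)%E.
Proof.
move=> d0 hY hI sA leA.
have mY v : measurable (Y @^-1` [set v]) by case: (hY v).
have mA v : measurable (A v).
  have := sA v; apply: smallest_sub; first exact: sigma_algebra_measurable.
  by move=> B [i _ [C mC <-]]; exact: measurable_funP.
have mB v : measurable (Y @^-1` [set v] `&` A v) by exact: measurableI.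
pose B (s : seq F) := [set x | (Y x \in s) /\ A (Y x) x].
have BC v s : B (v :: s) = (Y @^-1` [set v] `&` A v) `|` B s.
  apply/seteqP; split => x; rewrite /B /= inE.
    by move=> [/orP[/eqP <-|ys] Ay]; [left|right].
  by move=> [[<- Av]|[ys Ay]]; split=> //; rewrite ?eqxx ?ys ?orbT.
have mBs s : measurable (B s).
  elim: s => [|v s ih]; last by rewrite BC; exact: measurableU.
  by rewrite (_ : B [::] = set0) // -subset0 => x [].
have key s : (P (B s) <= (\sum_(v <- s) #|F|%:R^-1 * delta)%:E)%E.
  elim: s => [|v s ih].
    by rewrite big_nil (_ : B [::] = set0) ?measure0 // -subset0 => x [].
  rewrite BC big_cons EFinD; apply: le_trans (measureU2 _ (mB v) (mBs s)) _.
  apply: leeD ih; rewrite [leLHS](hI [set v] (A v) (sA v)).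
  have [_ ->] := hY v.
  by rewrite EFinM lee_wpmul2l ?lee_fin ?invr_ge0 // ler0n.
rewrite (_ : [set x | _] = B (enum F)); last first.
  apply/seteqP; split => x /=; rewrite /B /= mem_enum //.
  by case.
apply: le_trans (key _) _; rewrite lee_fin big_enum /= sumr_const.
rewrite -[leLHS]mulr_natr; have [->|Fn] := eqVneq #|F| 0%N.
  by rewrite mulr0.
by rewrite mulrAC mulVf ?mul1r // pnatr_eq0.
Qed.

Context (b w : nat) (U : edge b w -> {RV P >-> R}).
Hypothesis U_iid : iid_uniform01 U.

Lemma mart_tail_prob (Q : R) c m v0 K (C h : R) : (0 < m)%N -> 1 <= Q ->
  Q ^+ (b + w) <= C -> 0 < h ->
  (P [set x | (h < `|mart Q c m (rtab U (1 - Q^-1) x) v0 K|)%R]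
   <= ((1 - Q^-1) * C ^+ 2 * (b * w)%:R / h ^+ 2)%:E)%E.
Proof.
move=> m0 Q1 QC h0; have Q0 : 0 < Q := lt_le_trans ltr01 Q1.
have p01 : 0 <= 1 - Q^-1 <= 1.
  by rewrite subr_ge0 invf_le1 // Q1 gerBl invr_ge0 ltW.
rewrite (_ : [set x | _] = rtab U (1 - Q^-1) @^-1`
  [set t | h < `|mart Q c m t v0 K|]) // mu_sumE lee_fin.
apply: mart_tail => //.
- by move=> t; exact: mu_ge0.
- exact: mu_sum.
- by move=> e F hF; exact: mu_indep.
Qed.

(** Prim's algorithm only compares weights, so the event is a function of the table, here taken at
    level 0. *)
Lemma black_ratio_sigma v0 k (r eps : R) :
  sigma_of U [set x | eps < `|black_ratio (fun e => U e x) v0 k - r|].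
Proof.
apply: (@sigma_gen_sigma_of _ _ _ _ _ _ U predT).
rewrite (_ : [set x | _] = rtab U 0 @^-1` [set t |
  eps < `|#|(trun (b + w).+1 t v0 k :&: black b w)%SET|%:R / k%:R - r|]).
  exact: rtab_sigmaT.
by apply/seteqP; split => x /=; rewrite /black_ratio (prim_setE _ 0).
Qed.

(** The bad event forces one of the two martingales beyond [h]; the factor 2 is the union bound. *)
Lemma ratio_tail (Q : R) m v0 k (C h r eps : R) : (0 < m)%N -> 1 <= Q ->
  Q ^+ (b + w) <= C -> 0 < h ->
  (forall u, (forall c, `|mart Q c m (tab u (1 - Q^-1)) v0 (b + w)| <= h) ->
     `|black_ratio u v0 k - r| <= eps) ->
  (P [set x | (eps < `|black_ratio (fun e => U e x) v0 k - r|)%R]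
   <= (2 * ((1 - Q^-1) * C ^+ 2 * (b * w)%:R / h ^+ 2))%:E)%E.
Proof.
move=> m0 Q1 QC h0 hdet.
pose G c := [set x | h < `|mart Q c m (rtab U (1 - Q^-1) x) v0 (b + w)|].
have mG c : measurable (G c).
  exact: (rtab_meas U (1 - Q^-1) [set t | h < `|mart Q c m t v0 (b + w)|]).
have tail c := mart_tail_prob c v0 (b + w) m0 Q1 QC h0.
apply: (@le_trans _ _ (P (G true `|` G false))).
  apply: le_measure; rewrite ?inE.
  - have := @black_ratio_sigma v0 k r eps.
    by apply: smallest_sub; [exact: sigma_algebra_measurable
      |move=> B [i _ [D mD <-]]; exact: measurable_funP].
  - exact: measurableU.
  move=> x /= bad; apply/orP; rewrite -[_ || _]negbK negb_or -!leNgt.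
  apply/negP => /andP[g1 g2]; move: bad; rewrite ltNge => /negP; apply.
  by apply: hdet => -[].
apply: le_trans (measureU2 _ (mG true) (mG false)) _.
by rewrite mulr_natl mulr2n EFinD; apply: leeD; exact: tail.
Qed.

End Tail.

Theorem theorem2 (R : realType) (theta : R) (htheta : 0 < theta < 1)
    (nb nw : nat -> nat) (hn : forall n, (nb n + nw n)%N = n)
    (hlim : (fun n => (nb n)%:R / n%:R : R) @ \oo --> theta)
    (d : nat -> measure_display) (T : forall n, measurableType (d n))
    (P : forall n, probability (T n) R)
    (U : forall n, edge (nb n.+1) (nw n.+1) -> {RV (P n) >-> R})
    (sigma1 : forall n, T n -> vertex (nb n.+1) (nw n.+1))
    (hU : forall n, iid_uniform01 (U n))
    (hsigma1 : forall n, uniform_element (P n) (sigma1 n))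
    (hindep : forall n, independent_of (sigma1 n) (U n)) :
  (forall lambda : R, 1 < lambda -> exists! p, is_solution theta lambda p) /\
  (forall ell rho : R -> R,
    (forall lambda : R, 1 < lambda ->
       is_solution theta lambda (ell lambda, rho lambda)) ->
    set_bij `]1, +oo[ `]0, 1[ ell /\
    (forall s : R, 0 < s < 1 ->
       cvg_in_probability P
         (fun n x => black_ratio (fun e => U n e x) (sigma1 n x)
                       (Num.truncn (s * n.+1%:R)))
         (rho (pinv (`]1, +oo[ : set R) ell s)))).
Proof.
have /andP[t0 t1] := htheta; have t'0 : 0 < 1 - theta by rewrite subr_gt0.
have al0 := alpha_gt0 htheta; have al2 := alpha_sqr htheta.
have lam2 (lambda : R) : (alpha theta * lambda) ^+ 2 * (theta * (1 - theta)) = lambda ^+ 2.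
  by rewrite exprMn mulrAC al2 mul1r.
have uniq (lambda : R) (p q : R * R) : 1 < lambda -> is_solution theta lambda p ->
    is_solution theta lambda q -> p = q.
  move: p q => [l r] [l' r'] l1 /is_solutionE[s _] /is_solutionE[s' _].
  have a0 : 0 < alpha theta * lambda by rewrite mulr_gt0 // (lt_trans ltr01).
  have e1 := balanced_uniq_fst a0 t0 t'0 s s'.
  have e2 := balanced_uniq_fst a0 t'0 t0 (balanced_sym s) (balanced_sym s').
  have el : l = l'.
    have -> : l = r * l + (1 - r) * l by ring.
    by rewrite e1 e2; ring.
  have l0 : l != 0.
    by case: s => h _ _ _; apply: contraTneq h => ->; rewrite mulr0 ltxx.
  by move: e1; rewrite -el => /(mulIf l0) ->.
split.
  move=> lambda l1; have a0 : 0 < alpha theta * lambda by rewrite mulr_gt0 // (lt_trans ltr01).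
  have [|b [w s]] := balanced_exists a0 t0 t'0; first by rewrite lam2 exprn_egt1.
  exists (b + w, b / (b + w)); split; first exact: balanced_solution.
  by move=> q; apply: (uniq lambda) => //; exact: balanced_solution.
move=> ell rho sol.
have bal (lambda : R) : 1 < lambda ->
    balanced (alpha theta * lambda) theta (1 - theta)
      (rho lambda * ell lambda) ((1 - rho lambda) * ell lambda).
  by move=> /sol /is_solutionE[].
have ell_lt (l l' : R) : 1 < l -> l < l' -> ell l < ell l'.
  move=> l1 ll; have s := bal _ l1; have s' := bal _ (lt_trans l1 ll).
  have a0 : 0 < alpha theta * l by rewrite mulr_gt0 // (lt_trans ltr01).
  have aa : alpha theta * l < alpha theta * l' by rewrite ltr_pM2l.
  have h1 := balanced_lt a0 aa t0 t'0 s s'.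
  have h2 := balanced_lt a0 aa t'0 t0 (balanced_sym s) (balanced_sym s').
  (* [ell] is the sum of the two masses, each of which increases with the parameter. *)
  have E (z : R) : ell z = rho z * ell z + (1 - rho z) * ell z by ring.
  by rewrite (E l) (E l') ltrD.
have inj : {in `]1, +oo[%classic &, injective ell}.
  move=> l l'; rewrite !inE /= !in_itv /= !andbT => l1 l1' e.
  have [ll|ll|//] := ltgtP l l'.
    by have := ell_lt _ _ l1 ll; rewrite e ltxx.
  by have := ell_lt _ _ l1' ll; rewrite e ltxx.
have surj : set_surj `]1, +oo[ `]0, 1[ ell.
  move=> s /=; rewrite in_itv /= => s01.
  have tt : theta + (1 - theta) = 1 by ring.
  have [a [b [w [a0 sup bs bw]]]] := balanced_surj t0 t'0 tt s01.
  have aE : alpha theta * (a / alpha theta) = a by rewrite mulrC divfK // gt_eqF.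
  have l1 : 1 < a / alpha theta.
    have l0 : 0 < a / alpha theta by rewrite divr_gt0.
    rewrite -(@ltr_pXn2r _ 2) ?nnegrE ?ltW ?ltr01 // expr1n.
    by rewrite -lam2 aE.
  exists (a / alpha theta); first by rewrite /= in_itv /= l1.
  have bs' : balanced (alpha theta * (a / alpha theta)) theta (1 - theta) b w by rewrite aE.
  have [-> _] := uniq _ _ _ l1 (sol _ l1) (balanced_solution htheta bs').
  exact: bw.
split.
  split => // l /=; rewrite !in_itv /= andbT => l1.
  by have [_] := (is_solutionE _ _ _ _).1 (sol _ l1).
move=> s s01; have [|lambda /=] := surj s; first by rewrite /= in_itv.
rewrite in_itv /= andbT => l1 es.
have -> : pinv (`]1, +oo[ : set R) ell s = lambda.
  by rewrite -es pinvKV // inE /= in_itv /= l1.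
have bs := bal _ l1; set b0 := rho lambda * _ in bs; set w0 := (1 - _) * _ in bs.
have a0 : 0 < alpha theta * lambda by rewrite mulr_gt0 // (lt_trans ltr01).
set a := alpha theta * lambda in bs a0.
have bws : b0 + w0 = s by rewrite -es /b0 /w0; ring.
have s0 : 0 < s by case/andP: s01.
have rE : rho lambda = b0 / (b0 + w0) by rewrite bws /b0 es mulfK // gt_eqF.
move=> eps eps0; have [eta [e [N0 [eta0 e0 close]]]] := ratio_of_balance htheta a0 bs eps0.
(* On [n] vertices, [1 - Q^-1 <= a / n], [b * w <= n ^+ 2] and [h = eta * n] bound the tail by
   [K / n]. *)
pose C := expR a; pose K := 2 * (a * C ^+ 2 / eta ^+ 2).
have K0 : 0 <= K by rewrite mulr_ge0 // divr_ge0 ?sqr_ge0 // mulr_ge0 ?sqr_ge0 // ltW.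
apply: (@squeeze_cvge _ _ _ _ (fun=> 0%E) _ (fun n => (K / n.+1%:R)%:E)).
(* Index [n] refers to the graph on [n + 1] vertices, hence the shift. *)
- have hlimS : (fun n => (nb n.+1)%:R / n.+1%:R : R) @ \oo --> theta.
    by move: hlim; rewrite -cvg_shiftS.
  have near1 : \forall n \near \oo, N0 <= n.+1%:R :> R.
    near=> n; apply: (@le_trans _ _ n%:R); last by rewrite ler_nat.
    by near: n; exact: nbhs_infty_ger.
  have near2 : \forall n \near \oo, `|theta - (nb n.+1)%:R / n.+1%:R| <= eta.
    by move/cvgrPdist_le : hlimS => /(_ _ eta0).
  near=> n; rewrite measure_ge0 /=.
  have n1 : N0 <= n.+1%:R :> R by near: n.
  have n2 : `|(nb n.+1)%:R / n.+1%:R - theta| <= eta by rewrite distrC; near: n.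
  have N1 : 0 < n.+1%:R :> R by [].
  apply: (uniform_mixture (A := fun v => [set x | eps <
    `|black_ratio (fun e => U n e x) v (Num.truncn (s * n.+1%:R)) - rho lambda|])
    _ (hsigma1 n) (hindep n)).
  + by rewrite divr_ge0.
  + by move=> v; exact: black_ratio_sigma.
  move=> v; have cl u := close (nb n.+1) (nw n.+1) u v.
  rewrite /= hn in cl; pose Q := expR (a / n.+1%:R).
  pose m := (Num.truncn (e * n.+1%:R)).+1.
  have Q1 : 1 <= Q by rewrite -expR0 ler_expR divr_ge0 // ltW.
  have QN : Q ^+ (nb n.+1 + nw n.+1) <= C by rewrite hn /Q -expRM_natr divfK // gt_eqF.
  have h0 : 0 < eta * n.+1%:R by rewrite mulr_gt0.
  have m0 : (0 < m)%N by [].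
  apply: le_trans (ratio_tail (hU n) (r := rho lambda) m0 Q1 QN h0 _) _.
    move=> u hu; have [_ _ _] := cl u n1 n2; rewrite -rE bws; apply.
    by move=> c; have := hu c; rewrite hn.
  rewrite lee_fin /K -[leRHS]mulrA ler_pM2l //.
  have q1 : 1 - Q^-1 <= a / n.+1%:R.
    by rewrite -expRN; exact: hitp_leid.
  have bw : (nb n.+1 * nw n.+1)%:R <= n.+1%:R ^+ 2 :> R.
    rewrite -natrX ler_nat -mulnn leq_mul // -[X in (_ <= X)%N]hn.
      exact: leq_addr.
    exact: leq_addl.
  rewrite ler_pdivrMr ?exprn_gt0 //.
  have C2 : 0 <= C ^+ 2 by rewrite sqr_ge0.
  have q0 : 0 <= 1 - Q^-1 by rewrite subr_ge0 invf_le1 // (lt_le_trans ltr01).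
  rewrite (_ : _ * (eta * _) ^+ 2 = a / n.+1%:R * C ^+ 2 * n.+1%:R ^+ 2); last first.
    by field; apply/andP; split; rewrite gt_eqF.
  by apply: ler_pM => //; [rewrite mulr_ge0|apply: ler_wpM2r].
- exact: cvg_cst.
apply: cvg_EFin; first by near=> n.
rewrite -(mulr0 K); apply: cvgMl_tmp; exact: cvg_harmonic.
Unshelve. all: by end_near.
Qed.
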